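(* For a triangulation $\sigma$ of a polygon $P$ with vertices $P_1,\dots,P_n$ ($n\ge3$), let $T_\sigma=\bigoplus_{(P_s,P_t)\in\sigma,\ s<t}(s,t)$, the sum over all sides of $P$ and all diagonals of $\sigma$. Then $\sigma\mapsto T_\sigma$ is a bijection between the set of triangulations of $P$ and the set of isomorphism classes of basic cluster tilting objects of $\mathrm{CM}(\Lambda)$.
   Context: Let $K$ be a field, $R=K[x]$. $P$ has vertices $P_1,\dots,P_n$ labelled counterclockwise; a triangulation is a maximal set of pairwise non-crossing diagonals (segments between vertices in the interior of $P$; crossing = sharing an interior point); $(P_s,P_t)$ denotes the side or diagonal joining $P_s,P_t$. $\Lambda$ is the $R$-order in $M_n(K(x))$ whose $(i,j)$ entry ranges over $x^{c_{ij}}R$, where $c_{ij}=0$ for $i\le j$ except $c_{1n}=-1$, $c_{ij}=1$ if $i=j+1$, $c_{ij}=2$ if $i\ge j+2$. A Cohen–Macaulay $\Lambda$-module is a finitely generated left $\Lambda$-module which is free as an $R$-module; $\mathrm{CM}(\Lambda)$ is the full exact subcategory of $\operatorname{mod}\Lambda$ of such modules. For $1\le s<t\le n$, $(s,t)$ is the module of column vectors $[R^{s}\,(x)^{t-s}\,(x^2)^{n-t}]^t\subset K(x)^n$ ($s$ entries in $R$, $t-s$ in $xR$, $n-t$ in $x^2R$). An object $T$ of $\mathrm{CM}(\Lambda)$ is cluster tilting if $\operatorname{add}T=\{Z\mid \operatorname{Ext}^1_\Lambda(T,Z)=0\}=\{Z\mid\operatorname{Ext}^1_\Lambda(Z,T)=0\}$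 (within $\mathrm{CM}(\Lambda)$), where $\operatorname{add}T$ is the class of finite direct sums of direct summands of $T$; basic means pairwise non-isomorphic indecomposable summands. *)

(* Defs.v *)
From HB Require Import structures.
From mathcomp Require Import all_boot all_order all_algebra.
Set Implicit Arguments. Unset Strict Implicit. Unset Printing Implicit Defensive.
Import Order.TTheory GRing.Theory.
Local Open Scope ring_scope.

(* Indices are 0-based: i : 'I_n stands for the paper's index i+1.
   ccoef n i j = c_{ij} + 1  (shifted by one so it is a natural number):
   c_{ij} = 0 for i <= j except c_{1n} = -1, c_{ij} = 1 if i = j+1,
   c_{ij} = 2 if i >= j+2. *)
Definition ccoef (n : nat) (i j : 'I_n) : nat :=
  if (i <= j)%N then (if (i == 0 :> nat) && (j == n.-1 :> nat) then 0%N else 1%N)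
  else if (i == j.+1 :> nat) then 2%N else 3%N.

(* An element of Lambda is encoded by the matrix (a_ij) of polynomials such
   that the element is (x^{c_ij} a_ij) in M_n(K(x)).  Addition and
   R-scaling are entrywise; the product in these coordinates is
   (ab)_ij = sum_k x^{c_ik + c_kj - c_ij} a_ik b_kj  (exponent >= 0). *)
Definition lam_mul (K : fieldType) (n : nat) (A B : 'M[{poly K}]_n) : 'M[{poly K}]_n :=
  \matrix_(i, j) \sum_(k < n)
     'X^((ccoef i k + ccoef k j) - (ccoef i j).+1) * A i k * B k j.

(* A Cohen-Macaulay Lambda-module is free of finite rank over R = K[x];
   we model it as R^rk (column vectors) with the Lambda-action given by an
   R-algebra homomorphism act : Lambda -> M_rk(R). *)
Record lmod (K : fieldType) (n : nat) := LMod {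
  rk : nat ;
  act : 'M[{poly K}]_n -> 'M[{poly K}]_rk }.

Definition is_CM (K : fieldType) (n : nat) (M : lmod K n) : Prop :=
  [/\ (forall A B, act M (A + B) = act M A + act M B),
      (forall (p : {poly K}) A, act M (p *: A) = p *: act M A),
      (forall A B, act M (lam_mul A B) = act M A *m act M B)
    & act M 1%:M = 1%:M].

Definition is_hom (K : fieldType) (n : nat) (M N : lmod K n)
  (f : 'M[{poly K}]_(rk N, rk M)) : Prop :=
  forall A, f *m act M A = act N A *m f.

Definition iso (K : fieldType) (n : nat) (M N : lmod K n) : Prop :=
  exists (f : 'M[{poly K}]_(rk N, rk M)) (g : 'M[{poly K}]_(rk M, rk N)),
    [/\ is_hom f, is_hom g, g *m f = 1%:M & f *m g = 1%:M].

Definition zero_mod (K : fieldType) (n : nat) : lmod K n :=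
  @LMod K n 0 (fun _ => 0).

Definition dsum (K : fieldType) (n : nat) (M N : lmod K n) : lmod K n :=
  @LMod K n (rk M + rk N) (fun A => block_mx (act M A) 0 0 (act N A)).

Definition dsum_list (K : fieldType) (n : nat) (s : seq (lmod K n)) : lmod K n :=
  foldr (@dsum K n) (zero_mod K n) s.

Definition summand (K : fieldType) (n : nat) (X T : lmod K n) : Prop :=
  exists (i : 'M[{poly K}]_(rk T, rk X)) (p : 'M[{poly K}]_(rk X, rk T)),
    [/\ is_hom i, is_hom p & p *m i = 1%:M].

Definition in_add (K : fieldType) (n : nat) (T Z : lmod K n) : Prop :=
  exists s : seq (lmod K n), (forall i, (i < size s)%N -> summand (nth (zero_mod K n) s i) T) /\ iso Z (dsum_list s).

Definition ext1_zero (K : fieldType) (n : nat) (M N : lmod K n) : Prop :=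
  forall (E : lmod K n) (f : 'M[{poly K}]_(rk E, rk N)) (g : 'M[{poly K}]_(rk M, rk E)),
    is_CM E -> is_hom f -> is_hom g ->
    (forall v : 'cV[{poly K}]_(rk N), f *m v = 0 -> v = 0) ->
    (forall w : 'cV[{poly K}]_(rk M), exists v, g *m v = w) ->
    g *m f = 0 ->
    (forall v : 'cV[{poly K}]_(rk E), g *m v = 0 -> exists u, v = f *m u) ->
    exists h : 'M[{poly K}]_(rk E, rk M), is_hom h /\ g *m h = 1%:M.

Definition cluster_tilting (K : fieldType) (n : nat) (T : lmod K n) : Prop :=
  is_CM T /\
  forall Z : lmod K n, is_CM Z ->
    (in_add T Z <-> ext1_zero T Z) /\ (in_add T Z <-> ext1_zero Z T).

Definition indecomposable (K : fieldType) (n : nat) (X : lmod K n) : Prop :=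
  (0 < rk X)%N /\
  forall Y Z : lmod K n, iso X (dsum Y Z) -> rk Y = 0%N \/ rk Z = 0%N.

Definition basic (K : fieldType) (n : nat) (T : lmod K n) : Prop :=
  exists s : seq (lmod K n),
    [/\ iso T (dsum_list s),
        (forall i, (i < size s)%N -> indecomposable (nth (zero_mod K n) s i))
      & (forall i j, (i < size s)%N -> (j < size s)%N -> i <> j ->
           ~ iso (nth (zero_mod K n) s i) (nth (zero_mod K n) s j))].

(* The module (s,t), 1 <= s < t <= n (1-based): column vectors with s entries
   in R, t-s in xR, n-t in x^2 R.  In the R-basis (x^{d_k} e_k) the element
   (x^{c_ij} a_ij) of Lambda acts by the matrix (x^{c_ij + d_j - d_i} a_ij). *)
Definition dexp (n s t : nat) (k : 'I_n) : nat :=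
  if (k < s)%N then 0%N else if (k < t)%N then 1%N else 2%N.

Definition mod_st (K : fieldType) (n s t : nat) : lmod K n :=
  @LMod K n n (fun A => \matrix_(i, j)
     ('X^((ccoef i j + dexp s t j) - (dexp s t i).+1) * A i j)).

(* Vertex P_{i+1} is encoded by i : 'I_n.  A diagonal is a pair (i,j) with
   i < j, not adjacent along the boundary. *)
Definition is_diag (n : nat) (e : 'I_n * 'I_n) : bool :=
  (e.1 + 2 <= e.2)%N && ~~ ((e.1 == 0 :> nat) && (e.2 == n.-1 :> nat)).

Definition crossing (n : nat) (e f : 'I_n * 'I_n) : bool :=
  ((e.1 < f.1)%N && (f.1 < e.2)%N && (e.2 < f.2)%N) ||
  ((f.1 < e.1)%N && (e.1 < f.2)%N && (f.2 < e.2)%N).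

Definition triangulation (n : nat) (sigma : {set 'I_n * 'I_n}) : Prop :=
  [/\ (forall e, e \in sigma -> is_diag e),
      (forall e f, e \in sigma -> f \in sigma -> ~~ crossing e f)
    & (forall e, is_diag e -> e \notin sigma -> exists2 f, f \in sigma & crossing e f)].

Definition tri_pairs (n : nat) (sigma : {set 'I_n * 'I_n}) : seq (nat * nat) :=
  [seq (s, s.+1) | s <- iota 1 n.-1] ++ [:: (1%N, n)] ++
  [seq (((e.1 : nat).+1), ((e.2 : nat).+1)) | e : 'I_n * 'I_n <- enum sigma].

Definition T_sigma (K : fieldType) (n : nat) (sigma : {set 'I_n * 'I_n}) : lmod K n :=
  dsum_list [seq mod_st K n p.1 p.2 | p <- tri_pairs sigma].

(* Main.v *)
Require Import Defs.
From mathcomp Require Import all_boot all_order all_algebra.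
From mathcomp Require Import perm zify ring.
Set Implicit Arguments. Unset Strict Implicit. Unset Printing Implicit Defensive.
Import GRing.Theory.
Local Open Scope ring_scope.

(** A Cohen-Macaulay module M is a chain of R-lattices L_1 >= ... >= L_n in L_1 = R^r with
    x^2 L_1 <= L_n <= x L_1 and x L_i <= L_{i+1}, where L_j is the image of e_j M.  Take s maximal
    with L_s not inside x L_1, w in L_s outside x L_1, and t maximal with x w in L_t: then w spans a
    direct summand (s,t), so every Cohen-Macaulay module is a direct sum of modules (s,t).
    Since M is R-free, Ext^1(M,N) = 0 means that all derivations Lambda -> Hom_R(M,N) are inner;
    for M = (s,t) and N = (s',t') such a derivation amounts to an additive cocycle
    u_j - u_i in K(x) with prescribed valuations, and comparing valuations at the two jumps of
    (s,t) shows that Ext^1 vanishes exactly when the two segments do not cross.  Finally a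
    composite (s,t) -> (s',t') -> (s,t) with (s,t) <> (s',t') is divisible by x, so decompositions
    into modules (s,t) are unique, and basic cluster tilting objects correspond to maximal
    non-crossing sets of sides and diagonals. *)

(** The endomorphism ring of each (s,t) is R = K[x], which is not local, so the usual Krull-Schmidt
    argument does not apply. One matrix entry replaces it: at vertex 1 every (s,t) has exponent 0,
    identities have entry 1 there, and composites through a different (s',t') have an entry
    divisible by x. After inverting x the order becomes a full matrix ring, so finding a summand is
    a question about the fibre at x = 0: a vector and a functional are found by linear algebra over
    K, and their pairing, which lifts only to 1 + xq, is corrected to be exactly 1. A module here
    carries a basis by definition, so the complement of a summand must be shown free; this is why
    idempotent matrices over K[x] are split by Euclid's algorithm. The field K(x) never appears.
    Exponents are natural numbers with truncated subtraction, and an identity between Laurent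
    monomials is first multiplied by a power of x; the inequalities on [ccoef] and [dexp] show that
    nothing is truncated. *)

Local Notation hom M N := (@is_hom _ _ M N).

(** * Modules, extensions and derivations *)

Section Category.
Variables (K : fieldType) (n : nat).
Implicit Types M N X Y Z T : lmod K n.

Lemma hom_id M : hom M M 1%:M.
Proof. by move=> A; rewrite mul1mx mulmx1. Qed.

Lemma hom_comp X Y Z f g : hom X Y f -> hom Y Z g -> hom X Z (g *m f).
Proof. by move=> hf hg A; rewrite -mulmxA hf !mulmxA hg. Qed.

Lemma hom_sub X Y f g : hom X Y f -> hom X Y g -> hom X Y (f - g).
Proof. by move=> hf hg A; rewrite mulmxBl mulmxBr hf hg. Qed.

Lemma iso_refl X : iso X X.
Proof.
by exists 1%:M, 1%:M; split; rewrite ?mul1mx //; apply: hom_id.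
Qed.

Lemma iso_sym X Y : iso X Y -> iso Y X.
Proof. by case=> f [g [hf hg gf fg]]; exists g, f. Qed.

Lemma iso_trans X Y Z : iso X Y -> iso Y Z -> iso X Z.
Proof.
case=> f [g [hf hg gf fg]] [f' [g' [hf' hg' gf' fg']]].
exists (f' *m f), (g *m g'); split; try exact: hom_comp.
- by rewrite mulmxA -(mulmxA g) gf' mulmx1.
- by rewrite mulmxA -(mulmxA f') fg mulmx1.
Qed.

Lemma iso_rk X Y : iso X Y -> rk X = rk Y.
Proof.
by case=> f [g [_ _ /mulmx1_min le1 /mulmx1_min le2]]; apply/eqP; rewrite eqn_leq le1.
Qed.

Lemma iso_summand X Y : iso X Y -> summand X Y.
Proof. by case=> f [g [hf hg gf fg]]; exists f, g. Qed.

Lemma summand_trans X Y Z : summand X Y -> summand Y Z -> summand X Z.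
Proof.
case=> i [p [hi hp pi]] [i' [p' [hi' hp' pi']]].
exists (i' *m i), (p *m p'); split; try exact: hom_comp.
by rewrite mulmxA -(mulmxA p) pi' mulmx1.
Qed.

Lemma summand_CM X T : is_CM T -> summand X T -> is_CM X.
Proof.
case=> aD aZ aM a1 [i [p [hi hp pi]]].
have eqX A : act X A = p *m act T A *m i by rewrite -mulmxA -hi mulmxA pi mul1mx.
split=> [A B|q A|A B|].
- by rewrite !eqX aD mulmxDr mulmxDl.
- by rewrite !eqX aZ -scalemxAr -scalemxAl.
- by rewrite [act X B]eqX mulmxA mulmxA -hp eqX aM !mulmxA.
- by rewrite eqX a1 mulmx1.
Qed.

Lemma dsum_CM X Y : is_CM X -> is_CM Y -> is_CM (dsum X Y).
Proof.
case=> aD aZ aM a1 [bD bZ bM b1]; split=> [A B|q A|A B|] /=.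
- by rewrite aD bD add_block_mx !addr0.
- by rewrite aZ bZ scale_block_mx !scaler0.
- by rewrite aM bM mulmx_block !mul0mx !mulmx0 !addr0 !add0r.
- by rewrite a1 b1 -scalar_mx_block.
Qed.

Lemma zero_CM : is_CM (zero_mod K n).
Proof. by split=> *; apply/matrixP=> [[]]. Qed.

Lemma dsum_list_CM (I : eqType) (F : I -> lmod K n) (s : seq I) :
  (forall i, i \in s -> is_CM (F i)) -> is_CM (dsum_list (map F s)).
Proof.
elim: s => [|x s IH] h /=; first exact: zero_CM.
apply: dsum_CM; first by apply: h; rewrite mem_head.
by apply: IH => i si; apply: h; rewrite inE si orbT.
Qed.

Definition biproduct X M N i1 i2 p1 p2 : Prop :=
  [/\ hom M X i1, hom N X i2, hom X M p1 & hom X N p2] /\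
  [/\ p1 *m i1 = 1%:M, p2 *m i2 = 1%:M, p1 *m i2 = 0, p2 *m i1 = 0
    & i1 *m p1 + i2 *m p2 = 1%:M].

Lemma biproduct_iso X M N i1 i2 p1 p2 :
  @biproduct X M N i1 i2 p1 p2 -> iso X (dsum M N).
Proof.
case=> [[hi1 hi2 hp1 hp2] [e11 e22 e12 e21 e]].
exists (col_mx p1 p2), (row_mx i1 i2); split.
- by move=> A; rewrite mul_col_mx hp1 hp2 /= mul_block_col !mul0mx addr0 add0r.
- by move=> A; rewrite mul_mx_row -hi1 -hi2 /= mul_row_block !mulmx0 addr0 add0r.
- by rewrite mul_row_col.
- by rewrite mul_col_row e11 e22 e12 e21 -scalar_mx_block.
Qed.

Lemma dsum_biproduct M N :
  @biproduct (dsum M N) M N (col_mx 1%:M 0) (col_mx 0 1%:M)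
     (row_mx 1%:M 0) (row_mx 0 1%:M).
Proof.
pose simp := (mulmx0, mul0mx, mulmx1, mul1mx, addr0, add0r).
split; split; rewrite ?mul_row_col ?simp //.
- by move=> A; rewrite mul_col_mx /= mul_block_col !simp.
- by move=> A; rewrite mul_col_mx /= mul_block_col !simp.
- by move=> A; rewrite mul_mx_row /= mul_row_block !simp.
- by move=> A; rewrite mul_mx_row /= mul_row_block !simp.
- by rewrite !mul_col_row !simp add_block_mx !simp -scalar_mx_block.
Qed.

Lemma dsum_summandl M N : summand M (dsum M N).
Proof.
by have [[hi _ hp _] [e _ _ _ _]] := dsum_biproduct M N; exists (col_mx 1%:M 0), (row_mx 1%:M 0); split; first exact: hi.
Qed.

Lemma dsum_iso M M' N N' : iso M M' -> iso N N' -> iso (dsum M N) (dsum M' N').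
Proof.
case=> f [g [hf hg gf fg]] [f' [g' [hf' hg' gf' fg']]].
exists (block_mx f 0 0 f'), (block_mx g 0 0 g'); split.
- by move=> A; rewrite /= !mulmx_block !(mul0mx, mulmx0, addr0, add0r) hf hf'.
- by move=> A; rewrite /= !mulmx_block !(mul0mx, mulmx0, addr0, add0r) hg hg'.
- by rewrite !mulmx_block !(mul0mx, mulmx0, addr0, add0r) gf gf' -scalar_mx_block.
- by rewrite !mulmx_block !(mul0mx, mulmx0, addr0, add0r) fg fg' -scalar_mx_block.
Qed.

Lemma dsum_swap M N Z : iso (dsum M (dsum N Z)) (dsum N (dsum M Z)).
Proof.
pose i1 : 'M[{poly K}]_(rk M + (rk N + rk Z), rk N) := col_mx 0 (col_mx 1%:M 0).
pose p1 : 'M[{poly K}]_(rk N, rk M + (rk N + rk Z)) := row_mx 0 (row_mx 1%:M 0).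
pose i2 : 'M[{poly K}]_(rk M + (rk N + rk Z), rk M + rk Z) := block_mx 1%:M 0 0 (col_mx 0 1%:M).
pose p2 : 'M[{poly K}]_(rk M + rk Z, rk M + (rk N + rk Z)) := block_mx 1%:M 0 0 (row_mx 0 1%:M).
pose simp := (mulmx0, mul0mx, mulmx1, mul1mx, addr0, add0r).
apply: (@biproduct_iso (dsum M (dsum N Z)) N (dsum M Z) i1 i2 p1 p2); split; split.
- move=> A; rewrite /= !mul_block_col !mul_col_mx !simp; congr col_mx.
- move=> A; rewrite /= !mulmx_block mul_block_col !mul_col_mx !simp col_mx0; congr block_mx.
- move=> A; rewrite /= !mul_row_block !mul_mx_row !simp; congr row_mx.
- move=> A; rewrite /= !mulmx_block mul_row_block !mul_mx_row !simp row_mx0; congr block_mx.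
- by rewrite !mul_row_col !simp.
- by rewrite mulmx_block mul_row_col !simp -scalar_mx_block.
- by rewrite mul_row_block mul_row_col !simp row_mx0.
- by rewrite mul_block_col mul_row_col !simp col_mx0.
- rewrite mulmx_block !mul_col_row !mul_col_mx !mul_mx_row !simp.
  rewrite row_mx0 col_mx0 [LHS]add_block_mx !simp [X in block_mx _ _ _ X]add_block_mx !simp.
  by rewrite -!scalar_mx_block.
Qed.

Lemma dsum_list_rem (I : eqType) (F : I -> lmod K n) x (s : seq I) : x \in s ->
  iso (dsum_list (map F s)) (dsum (F x) (dsum_list (map F (rem x s)))).
Proof.
elim: s => //= y s IH; rewrite inE; case: eqVneq => [-> _|nxy /= xs].
  exact: iso_refl.
apply: iso_trans (dsum_swap _ _ _).
by apply: dsum_iso (IH xs); apply: iso_refl.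
Qed.

Lemma dsum_list_perm (I : eqType) (F : I -> lmod K n) (s t : seq I) : perm_eq s t ->
  iso (dsum_list (map F s)) (dsum_list (map F t)).
Proof.
elim: s t => [|x s IH] t pst.
  by move: pst; rewrite perm_sym => /perm_nilP ->; apply: iso_refl.
have xt : x \in t by rewrite -(perm_mem pst) mem_head.
apply: iso_trans (iso_sym (dsum_list_rem F xt)) => /=.
apply: dsum_iso; first exact: iso_refl.
by apply: IH; rewrite -(perm_cons x) (perm_trans pst) // perm_to_rem.
Qed.

Lemma dsum_list_summand (I : eqType) (F : I -> lmod K n) x (s : seq I) : x \in s ->
  summand (F x) (dsum_list (map F s)).
Proof.
by move=> /(dsum_list_rem F)/iso_sym/iso_summand; apply: summand_trans; apply: dsum_summandl.
Qed.

Definition derivation M N (D : 'M[{poly K}]_n -> 'M[{poly K}]_(rk N, rk M)) : Prop :=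
  [/\ forall A B, D (A + B) = D A + D B,
      forall p A, D (p *: A) = p *: D A
    & forall A B, D (lam_mul A B) = act N A *m D B + D A *m act M B].

Definition inner M N (D : 'M[{poly K}]_n -> 'M[{poly K}]_(rk N, rk M)) : Prop :=
  exists h, forall A, D A = act N A *m h - h *m act M A.

(* An extension of M by N splits over R, as M is R-free; the off-diagonal block of its
   action is a derivation, and the extension splits over Lambda iff this block is inner. *)
Definition all_inner M N : Prop := forall D, @derivation M N D -> inner D.

Lemma mulmx_col (R : pzSemiRingType) (m p q : nat) (A : 'M[R]_(m, p)) (B : 'M_(p, q)) j :
  col j (A *m B) = A *m col j B.
Proof. by rewrite !colE mulmxA. Qed.

(** As M is free over R, [g] has an R-linear section [s]. Its failure [G] to commute with the action
    lies in ker g = im f and pulls back along [f] to a derivation; if [h] makes this derivation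
    inner, then s - f h is a section over Lambda. *)
Lemma all_inner_ext1_zero M N : is_CM M -> all_inner M N -> ext1_zero M N.
Proof.
case=> mD mZ mM m1 inn E f g [eD eZ eM e1] hf hg finj gsur gf gker.
have /fin_all_exists [sc hsc] : forall j : 'I_(rk M), exists v : 'cV_(rk E), g *m v = col j 1%:M.
  by move=> j; apply: gsur.
pose s : 'M_(rk E, rk M) := \matrix_(i, j) sc j i 0.
have cols j : col j s = sc j by apply/colP=> i; rewrite !mxE.
have gs : g *m s = 1%:M.
  apply/row_matrixP=> i; apply/rowP => j.
  have := congr1 (fun c : 'cV_(rk M) => c i 0) (hsc j); rewrite -cols -mulmx_col !mxE => <-.
  by apply: eq_bigr => k _; rewrite !mxE.
have fcan (p : nat) (U V : 'M_(rk N, p)) : f *m U = f *m V -> U = V.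
  move=> e; apply/eqP; rewrite -subr_eq0; apply/eqP/matrixP=> i j.
  have /finj : f *m col j (U - V) = 0 by rewrite -mulmx_col mulmxBr e subrr col0.
  by move/(congr1 (fun c : 'cV_(rk N) => c i 0)); rewrite !mxE.
have lift p (U : 'M_(rk E, p)) : g *m U = 0 -> exists V, U = f *m V.
  move=> gU.
  have /fin_all_exists [vc hvc] : forall j, exists v : 'cV_(rk N), col j U = f *m v.
    by move=> j; apply: gker; rewrite -mulmx_col gU col0.
  exists (\matrix_(i, j) vc j i 0); apply/matrixP=> i j.
  have := congr1 (fun c : 'cV_(rk E) => c i 0) (hvc j); rewrite !mxE => ->.
  by apply: eq_bigr => k _; rewrite !mxE.
pose G A := act E A *m s - s *m act M A.
have gE A : g *m G A = 0.
  by rewrite mulmxBr !mulmxA hg gs -mulmxA gs mulmx1 mul1mx subrr.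
(* With f r = 1 - s g, preimages under [f] are given by one linear formula, uniformly in the
   infinitely many A; [lift] alone would choose a preimage for each A. *)
have [r hr] : exists r : 'M_(rk N, rk E), forall p (U : 'M_(rk E, p)), g *m U = 0 -> U = f *m (r *m U).
  have [r hr] : exists r : 'M_(rk N, rk E), 1%:M - s *m g = f *m r.
    by apply: lift; rewrite mulmxBr mulmxA gs mul1mx mulmx1 subrr.
  by exists r => p U gU; rewrite mulmxA -hr mulmxBl mul1mx -mulmxA gU mulmx0 subr0.
pose D A := r *m G A.
have fD A : f *m D A = G A by rewrite /D -hr.
have [|h hh] := inn D.
  split=> [A B|p A|A B].
  - by apply: fcan; rewrite mulmxDr !fD /G mD eD mulmxDl mulmxDr opprD addrACA.
  - by apply: fcan; rewrite -scalemxAr !fD /G mZ eZ -scalemxAl -scalemxAr scalerBr.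
  - apply: fcan; rewrite mulmxDr [f *m (_ *m D B)]mulmxA hf -mulmxA fD [f *m (_ *m act M B)]mulmxA fD /G eM mM fD /G mulmxBr mulmxBl.
    by rewrite !mulmxA [RHS]addrA subrK.
exists (s - f *m h); split; last by rewrite mulmxBr gs mulmxA gf mul0mx subr0.
move=> A; rewrite mulmxBl mulmxBr.
have := fD A; rewrite hh mulmxBr /G !mulmxA hf => e.
move: e.
move: (act E A *m s) (s *m act M A) (act E A *m f *m h) (f *m h *m act M A) => a b c d e.
have -> : a = c - d + b by rewrite e subrK.
by rewrite [c - _]addrC -[_ + c + b]addrA [c + b]addrC addrA addrK addrC.
Qed.

Lemma ext1_zero_all_inner M N : is_CM M -> is_CM N -> ext1_zero M N -> all_inner M N.
Proof.
case=> mD mZ mM m1 [nD nZ nM n1] ext D [dD dZ dM].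
(* This makes the unit of Lambda act as the identity on the extension [E] below. *)
have D1 : D 1%:M = 0.
  have l1 : lam_mul (1%:M : 'M[{poly K}]_n) 1%:M = 1%:M.
    apply/matrixP=> i j; rewrite !mxE (bigD1 i) //= big1 ?addr0 => [|k /negPf nk]; last first.
      by rewrite !mxE eq_sym nk mulr0 mul0r.
    rewrite !mxE eqxx mulr1; case: eqVneq => [<-|_]; last by rewrite mulr0.
    by rewrite /ccoef leqnn mulr1; case: ifP => _; rewrite ?subnn ?expr0.
  have := dM 1%:M 1%:M; rewrite l1 n1 m1 mul1mx mulmx1 => /eqP.
  by rewrite -subr_eq0 opprD addNKr oppr_eq0 => /eqP.
pose E := @LMod K n (rk N + rk M) (fun A => block_mx (act N A) (D A) 0 (act M A)).
have [|||||||h [hh h1]] := ext E (col_mx 1%:M 0) (row_mx 0 1%:M).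
- split=> [A B|q A|A B|] /=.
  + by rewrite mD nD dD add_block_mx addr0.
  + by rewrite mZ nZ dZ scale_block_mx scaler0.
  + by rewrite mM nM dM mulmx_block !mul0mx !mulmx0 !addr0 !add0r.
  + by rewrite m1 n1 D1 -scalar_mx_block.
- by move=> A; rewrite mul_col_mx /= mul_block_col !mul1mx mulmx1 !mul0mx !mulmx0 !addr0.
- by move=> A; rewrite mul_mx_row /= mul_row_block !mul1mx mulmx1 !mul0mx !mulmx0 !add0r.
- by move=> v; rewrite mul_col_mx mul1mx mul0mx => /(congr1 usubmx); rewrite col_mxKu linear0.
- by move=> w; exists (col_mx 0 w); rewrite mul_row_col mul0mx mul1mx add0r.
- by rewrite mul_row_col mulmx0 mul0mx addr0.
- move=> v; rewrite -[v]vsubmxK mul_row_col mul0mx mul1mx add0r => ->.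
  by exists (usubmx v); rewrite mul_col_mx mul1mx mul0mx.
move: h1 hh; rewrite -[h]vsubmxK mul_row_col mul0mx mul1mx add0r => -> hh.
exists (- usubmx h) => A.
have := hh A; rewrite mul_col_mx /= mul_block_col mul1mx mul0mx add0r mulmx1.
move=> /(congr1 usubmx); rewrite !col_mxKu mulmxN mulNmx opprK => ->.
by rewrite addKr.
Qed.

Lemma all_inner_summandl M N X : summand X M -> all_inner M N -> all_inner X N.
Proof.
case=> i [p [hi hp pi]] inn D [dD dZ dM].
have [|h hh] := inn (fun A => D A *m p).
  split=> [A B|q A|A B]; first by rewrite dD mulmxDl.
    by rewrite dZ -scalemxAl.
  by rewrite dM mulmxDl -!mulmxA hp.
exists (h *m i) => A; rewrite mulmxA -(mulmxA h) hi mulmxA -mulmxBl -hh.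
by rewrite -mulmxA pi mulmx1.
Qed.

Lemma all_inner_summandr M N X : summand X N -> all_inner M N -> all_inner M X.
Proof.
case=> i [p [hi hp pi]] inn D [dD dZ dM].
have [|h hh] := inn (fun A => i *m D A).
  split=> [A B|q A|A B]; first by rewrite dD mulmxDr.
    by rewrite dZ -scalemxAr.
  by rewrite dM mulmxDr !mulmxA hi.
exists (p *m h) => A; rewrite mulmxA -hp -!mulmxA -mulmxBr -hh.
by rewrite mulmxA pi mul1mx.
Qed.

Lemma all_inner_dsuml M1 M2 N :
  all_inner M1 N -> all_inner M2 N -> all_inner (dsum M1 M2) N.
Proof.
move=> inn1 inn2 D [dD dZ dM].
have [[hi1 hi2 hp1 hp2] [_ _ _ _ e]] := dsum_biproduct M1 M2.
have der X i : hom X (dsum M1 M2) i -> derivation (fun A => D A *m i : 'M_(rk N, rk X)).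
  move=> hi; split=> [A B|q A|A B]; first by rewrite dD mulmxDl.
    by rewrite dZ -scalemxAl.
  by rewrite dM mulmxDl -!mulmxA hi.
have [h1 e1] := inn1 _ (der _ _ hi1).
have [h2 e2] := inn2 _ (der _ _ hi2).
exists (row_mx h1 h2) => A.
rewrite /= mul_mx_row mul_row_block !mulmx0 addr0 add0r opp_row_mx add_row_mx.
rewrite -e1 -e2 -mul_mx_row -[LHS]mulmx1; congr (_ *m _).
by rewrite -block_mxEh -scalar_mx_block.
Qed.

Lemma all_inner_dsumr M N1 N2 :
  all_inner M N1 -> all_inner M N2 -> all_inner M (dsum N1 N2).
Proof.
move=> inn1 inn2 D [dD dZ dM].
have [[hi1 hi2 hp1 hp2] [_ _ _ _ e]] := dsum_biproduct N1 N2.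
have der X p : hom (dsum N1 N2) X p -> derivation (fun A => p *m D A : 'M_(rk X, rk M)).
  move=> hp; split=> [A B|q A|A B]; first by rewrite dD mulmxDr.
    by rewrite dZ -scalemxAr.
  by rewrite dM mulmxDr !mulmxA hp.
have [h1 e1] := inn1 _ (der _ _ hp1).
have [h2 e2] := inn2 _ (der _ _ hp2).
exists (col_mx h1 h2) => A.
rewrite /= mul_block_col mul_col_mx !mul0mx addr0 add0r opp_col_mx add_col_mx.
rewrite -e1 -e2 -mul_col_mx -[LHS]mul1mx; congr (_ *m _).
by rewrite -block_mxEv -scalar_mx_block.
Qed.

Lemma all_inner_listl (I : eqType) (F : I -> lmod K n) (s : seq I) N :
  (forall i, i \in s -> all_inner (F i) N) -> all_inner (dsum_list (map F s)) N.
Proof.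
elim: s => [|x s IH] h /=.
  by move=> D _; exists 0 => A; apply/matrixP=> i [].
apply: all_inner_dsuml; first by apply: h; rewrite mem_head.
by apply: IH => i si; apply: h; rewrite inE si orbT.
Qed.

Lemma all_inner_listr (I : eqType) (F : I -> lmod K n) (s : seq I) M :
  (forall i, i \in s -> all_inner M (F i)) -> all_inner M (dsum_list (map F s)).
Proof.
elim: s => [|x s IH] h /=.
  by move=> D _; exists 0 => A; apply/matrixP=> -[].
apply: all_inner_dsumr; first by apply: h; rewrite mem_head.
by apply: IH => i si; apply: h; rewrite inE si orbT.
Qed.

End Category.


(** * The modules (s,t) *)

Section Exponents.
Variable n : nat.
Hypothesis n3 : (2 < n)%N.
Implicit Types i j k : 'I_n.

Lemma ccoef_diag i : ccoef i i = 1%N.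
Proof. rewrite /ccoef leqnn; case: ifP => // /andP[/eqP i0 /eqP]; lia. Qed.

(** Without the shift by one this reads c_ij <= c_ik + c_kj: Lambda is closed under products, and
    the subtraction in [lam_mul] never truncates. *)
Lemma ccoef_triangle i k j : (ccoef i j < ccoef i k + ccoef k j)%N.
Proof.
have := (ltn_ord i, ltn_ord j, ltn_ord k) => -[[]]; rewrite /ccoef.
by do ![case: ifPn]; lia.
Qed.

(** Unshifted, d_i <= c_ij + d_j: the lattice (s,t) is stable under Lambda, and the exponents in
    [mod_st] are not truncated. *)
Lemma dexp_lt s t i j : (0 < s < t)%N -> (t <= n)%N ->
  (dexp s t i < ccoef i j + dexp s t j)%N.
Proof.
have := (ltn_ord i, ltn_ord j) => -[]; rewrite /ccoef /dexp.
by do ![case: ifPn]; lia.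
Qed.

Lemma dexp_neq s t s' t' :
  (0 < s < t)%N -> (t <= n)%N -> (0 < s' < t')%N -> (t' <= n)%N -> (s, t) <> (s', t') ->
  exists j, dexp s t j <> dexp s' t' j.
Proof.
move=> st tn st' tn' ne.
have [ss|ss] := eqVneq s s'.
  have tt : t <> t' by move=> tt; apply: ne; rewrite ss tt.
  have lt : (minn t t' < n)%N by lia.
  by exists (Ordinal lt); rewrite /dexp /=; do ![case: ifPn]; lia.
have lt : (minn s s' < n)%N by lia.
by exists (Ordinal lt); rewrite /dexp /=; do ![case: ifPn]; lia.
Qed.

End Exponents.

Section Standard.
Variables (K : fieldType) (n : nat).
Hypothesis n3 : (2 < n)%N.
Implicit Types (i j k : 'I_n) (s t : nat).

Lemma lam_mul_delta i j k l :
  lam_mul (delta_mx i j : 'M[{poly K}]_n) (delta_mx k l) =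
  if j == k then 'X^(ccoef i j + ccoef j l - (ccoef i l).+1) *: delta_mx i l else 0.
Proof.
apply/matrixP=> a b; rewrite mxE (bigD1 j) //= big1 => [|m /negPf mj]; last first.
  by rewrite !mxE mj andbF mulr0 mul0r.
case: eqVneq => [<-|jk]; rewrite !mxE ?eqxx ?andbT addr0 ?(negPf jk) ?mulr0 //.
by case: eqVneq => [->|]; case: eqVneq => [->|]; rewrite /= ?(mulr1, mulr0, mul0r).
Qed.

Lemma matrix_lin_ext (m p : nat) (F G : 'M[{poly K}]_n -> 'M[{poly K}]_(m, p)) :
  (forall A B, F (A + B) = F A + F B) -> (forall q A, F (q *: A) = q *: F A) ->
  (forall A B, G (A + B) = G A + G B) -> (forall q A, G (q *: A) = q *: G A) ->
  (forall i j, F (delta_mx i j) = G (delta_mx i j)) -> F =1 G.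
Proof.
move=> FD FZ GD GZ FG A.
have F0 : F 0 = 0 by rewrite -(scale0r (0 : 'M_n)) FZ scale0r.
have G0 : G 0 = 0 by rewrite -(scale0r (0 : 'M_n)) GZ scale0r.
rewrite [A]matrix_sum_delta (big_morph F FD F0) (big_morph G GD G0).
apply: eq_bigr => i _; rewrite (big_morph F FD F0) (big_morph G GD G0).
by apply: eq_bigr => j _; rewrite FZ GZ FG.
Qed.

Lemma is_hom_delta (M N : lmod K n) f : is_CM M -> is_CM N ->
  (forall i j, f *m act M (delta_mx i j) = act N (delta_mx i j) *m f) -> hom M N f.
Proof.
move=> [mD mZ _ _] [nD nZ _ _]; apply: matrix_lin_ext => [A B|q A|A B|q A].
- by rewrite mD mulmxDr.
- by rewrite mZ -scalemxAr.
- by rewrite nD mulmxDl.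
- by rewrite nZ -scalemxAl.
Qed.

Lemma derivation_inner (M N : lmod K n) D h : is_CM M -> is_CM N -> derivation D ->
  (forall i j, D (delta_mx i j) =
     act N (delta_mx i j) *m h - h *m act M (delta_mx i j)) -> @inner K n M N D.
Proof.
move=> [mD mZ _ _] [nD nZ _ _] [dD dZ _] e; exists h.
apply: matrix_lin_ext e => // [A B|q A].
- by rewrite mD nD mulmxDl mulmxDr opprD addrACA.
- by rewrite nZ mZ -scalemxAl -scalemxAr scalerBr.
Qed.

Lemma act_st_delta s t i j :
  act (mod_st K n s t) (delta_mx i j) =
  'X^(ccoef i j + dexp s t j - (dexp s t i).+1) *: delta_mx i j.
Proof.
apply/matrixP=> a b; rewrite !mxE.
by case: eqVneq => [->|]; case: eqVneq => [->|]; rewrite ?mulr0.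
Qed.

Lemma act_st_idem s t i : act (mod_st K n s t) (delta_mx i i) = delta_mx i i.
Proof. by rewrite act_st_delta ccoef_diag // add1n subnn scale1r. Qed.

Lemma mod_st_CM s t : (0 < s < t)%N -> (t <= n)%N -> is_CM (mod_st K n s t).
Proof.
move=> st tn; split=> [A B|q A|A B|]; apply/matrixP=> i j; rewrite !mxE; move: i j => /= i j.
- by rewrite mulrDr.
- by rewrite mulrCA.
- rewrite mulr_sumr; apply: eq_bigr => k _; rewrite !mxE.
  have e : (ccoef i j + dexp s t j - (dexp s t i).+1 +
            (ccoef i k + ccoef k j - (ccoef i j).+1) =
            ccoef i k + dexp s t k - (dexp s t i).+1 +
            (ccoef k j + dexp s t j - (dexp s t k).+1))%N.
    have := (ccoef_triangle n3 i k j, dexp_lt n3 i j st tn, dexp_lt n3 i k st tn, dexp_lt n3 k j st tn).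
    by move=> [[[e1 e2] e3] e4]; lia.
  rewrite -!mulrA mulrA -exprD e exprD -!mulrA; congr (_ * _).
  by rewrite mulrCA.
- case: eqVneq => [->|]; last by rewrite mulr0.
  by rewrite ccoef_diag // add1n subnn mulr1.
Qed.

Lemma hom_st_diag s t s' t' f i j :
  hom (mod_st K n s t) (mod_st K n s' t') f -> i != j -> f i j = 0.
Proof.
move=> /(_ (delta_mx j j)); rewrite !act_st_idem => /matrixP/(_ i j) e ij.
move: e; rewrite !mxE (bigD1 j) //= big1 => [|k /negPf kj]; last by rewrite !mxE kj mulr0.
rewrite mxE !eqxx mulr1 addr0 => ->; rewrite big1 // => k _.
by rewrite mxE (negPf ij) mul0r.
Qed.

(** Over K(x) both modules become K(x)^n, where a homomorphism is multiplication by one scalar u. In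
    the bases x^(d_k) e_k its k-th diagonal entry is u x^(d_k - d'_k); two such entries are compared
    here with the negative exponents cleared. *)
Lemma hom_st_entry s t s' t' f i j :
  (0 < s < t)%N -> (t <= n)%N -> (0 < s' < t')%N -> (t' <= n)%N ->
  hom (mod_st K n s t) (mod_st K n s' t') f ->
  f i i * 'X^(dexp s t j + dexp s' t' i) = 'X^(dexp s' t' j + dexp s t i) * f j j.
Proof.
move=> st tn st' tn' /(_ (delta_mx i j)); rewrite !act_st_delta => /matrixP/(_ i j).
rewrite !mxE (bigD1 i) //= [X in _ = X](bigD1 j) //= !big1 => [|k /negPf kj|k /negPf kj]; last 2 first.
- by rewrite !mxE kj /= ?andbF !(mulr0, mul0r).
- by rewrite !mxE kj /= ?andbF !(mulr0, mul0r).
rewrite !mxE !eqxx !mulr1 !addr0 => e.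
have := (dexp_lt n3 i j st tn, dexp_lt n3 i j st' tn') => -[l1 l2].
apply: (@mulIf _ 'X^(ccoef i j)); first by rewrite expf_neq0 ?polyX_eq0.
rewrite mulrAC -!mulrA [f j j * _]mulrC !mulrA -!exprD -mulrA -exprD.
have -> : (ccoef i j + (dexp s t j + dexp s' t' i) =
   ccoef i j + dexp s t j - (dexp s t i).+1 + ((dexp s t i).+1 + dexp s' t' i))%N by lia.
have -> : (dexp s' t' j + dexp s t i + ccoef i j =
   (ccoef i j + dexp s' t' j - (dexp s' t' i).+1) + ((dexp s t i).+1 + dexp s' t' i))%N by lia.
rewrite [in LHS]exprD [LHS]mulrA e [in RHS]exprD.
by rewrite mulrAC.
Qed.

End Standard.


(** * Homomorphisms between the modules (s,t), indecomposability and uniqueness *)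

Definition edge (n : nat) (e : nat * nat) : bool := (0 < e.1 < e.2)%N && (e.2 <= n)%N.

Definition edge_mod (K : fieldType) (n : nat) (e : nat * nat) : lmod K n :=
  mod_st K n e.1 e.2.

Section EdgeModules.
Variables (K : fieldType) (n : nat).
Hypothesis n3 : (2 < n)%N.
Implicit Types (e : nat * nat).

(** Every (s,t) has exponent 0 at this vertex, so the entry of a homomorphism at [o] is the scalar
    by which it multiplies. *)
Let o : 'I_n := Ordinal (ltn_trans (ltn0Sn 1) n3).

Lemma edge_mod_CM e : edge n e -> is_CM (edge_mod K n e).
Proof. by case/andP; apply: mod_st_CM. Qed.

Lemma dexp_first s t (i : 'I_n) : (0 < s)%N -> i = 0 :> nat -> dexp s t i = 0%N.
Proof. by move=> s0 i0; rewrite /dexp i0 s0. Qed.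

Lemma hom_edge_entry e e' f j : edge n e -> edge n e' ->
  hom (edge_mod K n e) (edge_mod K n e') f ->
  f o o * 'X^(dexp e.1 e.2 j) = 'X^(dexp e'.1 e'.2 j) * f j j.
Proof.
move=> /andP[st tn] /andP[st' tn'] /(hom_st_entry n3 o j st tn st' tn').
by rewrite !(@dexp_first _ _ o) ?addn0 //; lia.
Qed.

Lemma hom_edge_diag e e' f i j :
  hom (edge_mod K n e) (edge_mod K n e') f -> i != j -> f i j = 0.
Proof. exact: hom_st_diag. Qed.

Lemma edge_end_scalar e f : edge n e ->
  hom (edge_mod K n e) (edge_mod K n e) f -> f = (f o o)%:M.
Proof.
move=> ee hf; apply/matrixP=> i j; rewrite [RHS]mxE; case: eqVneq => [->|ij].
  have := hom_edge_entry j ee ee hf; rewrite mulrC => /mulfI -> //.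
  by rewrite expf_neq0 ?polyX_eq0.
by rewrite (hom_edge_diag hf ij).
Qed.

(** The idempotent that projects onto Y is a scalar in the domain R, hence 0 or 1, and then Y or Z
    has zero identity matrix. *)
Lemma edge_mod_indecomposable e : edge n e -> indecomposable (edge_mod K n e).
Proof.
move=> ee; split=> [|Y Z]; first by rewrite /=; lia.
case=> f [g [hf hg gf fg]].
have [[hi1 hi2 hp1 hp2] [pi1 pi2 _ _ ip]] := dsum_biproduct Y Z.
move: hi1 hi2 hp1 hp2 pi1 pi2 ip.
move: (col_mx 1%:M 0) (row_mx 1%:M 0) (col_mx 0 1%:M) (row_mx 0 1%:M) => i1 p1 i2 p2.
move=> hi1 hi2 hp1 hp2 pi1 pi2 ip.
have h1 := hom_comp (hom_comp hf hp1) (hom_comp hi1 hg).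
have := edge_end_scalar ee h1; set q := _ o o => eq1.
have idem : q * q = q.
  have : (q%:M : 'M_n) *m q%:M = q%:M.
    rewrite -eq1 !mulmxA -(mulmxA _ f g) fg mulmx1 -(mulmxA _ p1 i1) pi1 mulmx1 //.
  by rewrite -scalar_mxM => /matrixP/(_ o o); rewrite !mxE eqxx.
have rk0 (X : lmod K n) : (1%:M : 'M[{poly K}]_(rk X)) = 0 -> rk X = 0%N.
  case: (rk X) => // r /matrixP/(_ ord0 ord0); rewrite !mxE => /eqP.
  by rewrite oner_eq0.
have : q * (q - 1) = 0 by rewrite mulrBr idem mulr1 subrr.
move/eqP; rewrite mulf_eq0 subr_eq0 => /orP[] /eqP q1.
(* The identity of Y is written as its own square, so that g i1 p1 f, which is [q] = 0, appears in
   the middle. *)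
- left; apply: rk0; rewrite -[1%:M]mulmx1 -{1}pi1 -pi1 -[i1 in X in _ *m X]mul1mx -fg.
  rewrite -[p1 in X in X *m _]mulmx1 -fg !mulmxA.
  have -> : p1 *m f *m g *m i1 *m p1 *m f *m g *m i1 = p1 *m f *m (g *m i1 *m (p1 *m f)) *m g *m i1.
    by rewrite !mulmxA.
  by rewrite eq1 q1 raddf0 mulmx0 !mul0mx.
- right; apply: rk0.
  have e0 : g *m (i2 *m p2) *m f = 0.
    have -> : i2 *m p2 = 1%:M - i1 *m p1 by rewrite -ip addrC addKr.
    rewrite mulmxBr mulmxBl mulmx1 gf -mulmxA; move: eq1; rewrite -!mulmxA q1 => ->.
    by rewrite subrr.
  have -> : (1%:M : 'M_(rk Z)) = p2 *m f *m (g *m (i2 *m p2) *m f) *m g *m i2.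
    by rewrite !mulmxA; do 2!rewrite -(mulmxA _ f g) fg mulmx1; rewrite pi2 mul1mx pi2.
  by rewrite e0 mulmx0 !mul0mx.
Qed.

(** Let u and v be the scalars of [f] and [g]. At a vertex where the exponents differ, one of the
    entries u x^(d - d') and v x^(d' - d) has a negative power of x but lies in R, so x divides u or
    v. *)
Lemma edge_factor_dvd e e' f g : edge n e -> edge n e' -> e <> e' ->
  hom (edge_mod K n e) (edge_mod K n e') f -> hom (edge_mod K n e') (edge_mod K n e) g ->
  'X %| (g *m f) o o.
Proof.
move=> ee ee' ne hf hg.
have -> : (g *m f) o o = g o o * f o o.
  rewrite mxE (bigD1 o) //= big1 ?addr0 // => k ko.
  by rewrite (hom_edge_diag hf ko) mulr0.
have dvd (e1 e2 : nat * nat) h : edge n e1 -> edge n e2 -> hom (edge_mod K n e1) (edge_mod K n e2) h ->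
  forall j : 'I_n, (dexp e1.1 e1.2 j < dexp e2.1 e2.2 j)%N -> 'X %| h o o.
  move=> ee1 ee2 hh j lt; have := hom_edge_entry j ee1 ee2 hh.
  rewrite -(subnK lt) -addSnnS exprD mulrAC => /mulIf ->; last by rewrite expf_neq0 ?polyX_eq0.
  by rewrite exprS -mulrA dvdp_mulr.
have [j nej] : exists j : 'I_n, dexp e.1 e.2 j <> dexp e'.1 e'.2 j.
  by move: ee ee' ne => /andP[? ?] /andP[? ?] ne; apply: dexp_neq => // -[a b]; apply: ne; apply/eqP; rewrite -pair_eqE /= a b !eqxx.
have [lt|lt|//] := ltngtP (dexp e.1 e.2 j) (dexp e'.1 e'.2 j).
- by rewrite dvdp_mull // (dvd _ _ _ ee ee' hf j).
- by rewrite dvdp_mulr // (dvd _ _ _ ee' ee hg j).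
Qed.

(** This takes the place of Krull-Schmidt: if [e] is not listed, the identity is a sum of composites
    through other edges, all divisible by x at vertex [o]. *)
Lemma edge_summand_mem e (s : seq (nat * nat)) : edge n e -> all (edge n) s ->
  summand (edge_mod K n e) (dsum_list (map (edge_mod K n) s)) -> e \in s.
Proof.
move=> ee es [i [p [hi hp pi]]]; apply: contraT => nes.
suff : 'X %| (p *m i) o o.
  rewrite pi mxE eqxx => /dvdp_leq; rewrite oner_eq0 => /(_ isT).
  by rewrite size_polyX size_poly1.
(* The induction carries divisibility for arbitrary [i] and [p], since their components along a
   smaller sum no longer compose to the identity. *)
clear pi; move: i p hi hp; elim: s es nes => [|e' s IH] /= es nes i p hi hp.
  by rewrite mxE big1 ?dvdp0 // => -[].
have [[hi1 hi2 hp1 hp2] [_ _ _ _ ip]] := dsum_biproduct (edge_mod K n e') (dsum_list (map (edge_mod K n) s)).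
move: hi1 hi2 hp1 hp2 ip.
move: (col_mx 1%:M 0) (row_mx 1%:M 0) (col_mx 0 1%:M) (row_mx 0 1%:M) => i1 p1 i2 p2.
move=> hi1 hi2 hp1 hp2 ip.
move: nes es; rewrite inE negb_or => /andP[/eqP ne nes] /andP[ee' es].
have -> : p *m i = (p *m i1) *m (p1 *m i) + (p *m i2) *m (p2 *m i).
  by rewrite -!mulmxA -mulmxDr !(mulmxA _ _ i) -mulmxDl ip mul1mx.
rewrite mxE dvdp_add //.
  exact: (edge_factor_dvd ee ee' ne (hom_comp hi hp1) (hom_comp hi1 hp)).
exact: (IH es nes _ _ (hom_comp hi hp2) (hom_comp hi2 hp)).
Qed.

Lemma edge_mod_inj e e' : edge n e -> edge n e' ->
  iso (edge_mod K n e) (edge_mod K n e') -> e = e'.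
Proof.
move=> ee ee' /iso_summand se; have : e \in [:: e'].
  apply: edge_summand_mem; rewrite //= ?ee' //.
  exact: summand_trans se (dsum_summandl _ _).
by rewrite inE => /eqP.
Qed.

End EdgeModules.


Definition cross (e f : nat * nat) : bool :=
  (e.1 < f.1 < e.2)%N && (e.2 < f.2)%N || (f.1 < e.1 < f.2)%N && (f.2 < e.2)%N.

(** * Extensions between the modules (s,t) *)

Section CrossingExponents.
Variable n : nat.
Hypothesis n3 : (2 < n)%N.
Implicit Types (i j k m p : 'I_n).

(* The vector of (s,t) at vertex k is generated by the one at vertex p. *)
Definition generates s t p k : bool := (ccoef k p + dexp s t p <= (dexp s t k).+1)%N.

Lemma dexp_sum s t k : (s < t)%N -> dexp s t k = ((s <= k) + (t <= k))%N.
Proof. by rewrite /dexp; case: (ltnP k s); case: (ltnP k t); lia. Qed.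

Lemma dexp_mono s t i j : (s < t)%N -> (i <= j)%N -> (dexp s t i <= dexp s t j)%N.
Proof. by move=> st ij; rewrite !dexp_sum //; lia. Qed.

Lemma dexp_le2 s t k : (dexp s t k <= 2)%N.
Proof. by rewrite /dexp; do ![case: ifP]. Qed.

Lemma dexp_low s t k : (k < s)%N -> dexp s t k = 0%N.
Proof. by rewrite /dexp => ->. Qed.

Lemma dexp_mid s t k : (s <= k < t)%N -> dexp s t k = 1%N.
Proof. by rewrite /dexp => /andP[+ ->]; rewrite leqNgt => /negPf->. Qed.

Lemma dexp_high s t k : (s < t <= k)%N -> dexp s t k = 2.
Proof. by move=> st; rewrite dexp_sum; lia. Qed.

Lemma generates_top s t p k : (0 < s < t)%N -> (t <= n)%N -> p = s.-1 :> nat ->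
  ((k <= s) || (t <= k))%N -> generates s t p k.
Proof.
have := (ltn_ord k, ltn_ord p) => -[]; rewrite /generates /ccoef /dexp.
by do ![case: ifPn]; lia.
Qed.

Lemma generates_middle s t p k : (0 < s < t)%N -> (t <= n)%N -> p = t.-1 :> nat ->
  (s <= k <= t)%N || (k == 0 :> nat) && (t == n) -> generates s t p k.
Proof.
have := (ltn_ord k, ltn_ord p) => -[]; rewrite /generates /ccoef /dexp.
by do ![case: ifPn]; lia.
Qed.

(* The (0-based) vertices s-1 and t-1 generate (s,t).  Every vertex is reached from p either directly, or
   through the other generator p' and a common vertex m whose valuation is large enough. *)
Lemma noncrossing_glue e f : edge n e -> edge n f -> ~~ cross e f ->
  let d := dexp e.1 e.2 in let d' := dexp f.1 f.2 in let g := generates e.1 e.2 in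
  exists p, forall k, g p k \/
    exists p' m, [/\ g p m, g p' m, g p' k & (d' k + d m <= d' m + d k)%N].
Proof.
case: e f => s t [s' t'] /andP[/= st tn] /andP[/= st' tn'] /= ncr.
have an : (s.-1 < n)%N by lia.
have bn : (t.-1 < n)%N by lia.
have sn : (s < n)%N by lia.
(* The generator at s-1 reaches the cyclic interval from t to s, the one at t-1 the interval from s
   to t. They meet at [c] = s and at [o] = t, where t is read cyclically as 0 if t = n. *)
have on : ((if t < n then t else 0) < n)%N by case: ifP; lia.
pose a := Ordinal an; pose b := Ordinal bn; pose c := Ordinal sn; pose o := Ordinal on.
have ga (k : 'I_n) : ((k <= s) || (t <= k))%N -> generates s t a k by apply: generates_top.
have gb (k : 'I_n) : (s <= k <= t)%N || (k == 0 :> nat) && (t == n) -> generates s t b k.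
  exact: generates_middle.
have gac : generates s t a c by apply: ga; rewrite leqnn.
have gbc : generates s t b c by apply: gb => /=; lia.
have gao : generates s t a o by apply: ga => /=; case: ifP; lia.
have gbo : generates s t b o by apply: gb => /=; case: ifP; lia.
(* One alternative for each base generator and meeting vertex. As [dexp s' t'] is monotone, the
   inequality is only asked at s-1 or t-1, the critical vertex of the part reached through the other
   generator. *)
have : [|| dexp s' t' a < dexp s' t' c, dexp s' t' b <= dexp s' t' c,
           dexp s' t' a + dexp s t o <= dexp s' t' o
         | dexp s' t' b + dexp s t o <= (dexp s' t' o).+1]%N.
  have s't' : (s' < t')%N by lia.
  have [tlt|tge] := ltnP t n.
    rewrite (@dexp_high s t o) /= ?tlt; last by lia.
    by move: ncr; rewrite !dexp_sum //= tlt /cross /=; lia.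
  rewrite (@dexp_low s t o) /= ?ltnNge ?tge /=; last by lia.
  by move: ncr; rewrite !dexp_sum //= ltnNge tge /cross /=; lia.
have fromb m : (forall k : 'I_n, ~~ (s <= k < t)%N -> (dexp s' t' k + dexp s t m <= dexp s' t' m + dexp s t k)%N) ->
    generates s t a m -> generates s t b m -> exists p, forall k, generates s t p k \/
    exists p' m', [/\ generates s t p m', generates s t p' m', generates s t p' k &
     (dexp s' t' k + dexp s t m' <= dexp s' t' m' + dexp s t k)%N].
  move=> le gam gbm; exists b => k; case: (boolP (s <= k < t)%N) => kst.
    by left; apply: gb; rewrite (andP kst).1 ltnW ?(andP kst).2.
  by right; exists a, m; split; rewrite ?le //; apply: ga; lia.
have froma m : (forall k : 'I_n, (s <= k < t)%N -> (dexp s' t' k + dexp s t m <= dexp s' t' m + dexp s t k)%N) ->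
    generates s t a m -> generates s t b m -> exists p, forall k, generates s t p k \/
    exists p' m', [/\ generates s t p m', generates s t p' m', generates s t p' k &
     (dexp s' t' k + dexp s t m' <= dexp s' t' m' + dexp s t k)%N].
  move=> le gam gbm; exists a => k; case: (boolP (s <= k < t)%N) => kst.
    by right; exists b, m; split; rewrite ?le //; apply: gb; lia.
  by left; apply: ga; lia.
have out (k : 'I_n) : ~~ (s <= k < t)%N -> (k < s)%N \/ (t <= k)%N by lia.
have s't' : (s' < t')%N by lia.
have cmid : dexp s t c = 1%N by apply: dexp_mid => /=; lia.
case/or4P => le.
- apply: (fromb c) => // k /out[ks|tk]; rewrite cmid.
    have := @dexp_mono s' t' k a s't' _; rewrite (dexp_low t ks) /=; lia.
  have := dexp_le2 s' t' k; rewrite (@dexp_high s t k) /=; lia.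
- apply: (froma c) => // k kst; rewrite cmid (dexp_mid kst).
  have := @dexp_mono s' t' k b s't' _; rewrite /=; lia.
- apply: (fromb o) => // k /out[ks|tk].
    have := @dexp_mono s' t' k a s't' _; rewrite (dexp_low t ks) /=; lia.
  have := dexp_le2 s' t' k; rewrite (@dexp_high s t k) /=; lia.
- apply: (froma o) => // k kst; rewrite (dexp_mid kst).
  have := @dexp_mono s' t' k b s't' _; rewrite /=; lia.
Qed.

(* No generator relation of Lambda between Q and its complement is tight, so the cocycle
   x^{r-1} 1_Q is a derivation; its value on (a,b) has too small a valuation to be inner. *)
Lemma crossing_cut e f : edge n e -> edge n f -> cross e f ->
  let d := dexp e.1 e.2 in let d' := dexp f.1 f.2 in
  exists (Q : 'I_n -> bool) (r : nat) a b,
    [/\ forall i j, Q i != Q j -> (d' i + 2 <= ccoef i j + d j + r)%N, Q a != Q b,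
        (d a = 0%N) * (d b = 1%N), (d' a = r) * (d' b = r.+1) & (0 < ccoef a b)%N].
Proof.
case: e f => s t [s' t'] /andP[/= st tn] /andP[/= st' tn'] cr /=.
have an : (s.-1 < n)%N by lia.
have bn : (t.-1 < n)%N by lia.
have cab : (0 < ccoef (Ordinal an) (Ordinal bn))%N.
  by move: cr; rewrite /cross /ccoef /=; do ![case: ifPn]; lia.
(* In both cases Q runs from s' to the one of s, t lying strictly between s' and t', so it contains
   exactly one of the vertices s-1 and t-1; r is the exponent of (s',t') at s-1. *)
case/orP: cr => /= cr; last first.
  exists (fun k : 'I_n => (s' <= k < s)%N), 1%N, (Ordinal an), (Ordinal bn).
  split; last exact: cab.
  - move=> i j; have := (ltn_ord i, ltn_ord j) => -[]; rewrite /ccoef /dexp.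
    by do ![case: ifPn]; lia.
  - by rewrite /=; lia.
  - by split; rewrite dexp_sum /=; lia.
  - by split; rewrite dexp_sum /=; lia.
exists (fun k : 'I_n => (s' <= k < t)%N), 0%N, (Ordinal an), (Ordinal bn).
split; last exact: cab.
- move=> i j; have := (ltn_ord i, ltn_ord j) => -[]; rewrite /ccoef /dexp.
  by do ![case: ifPn]; lia.
- by rewrite /=; lia.
- by split; rewrite dexp_sum /=; lia.
- by split; rewrite dexp_sum /=; lia.
Qed.

End CrossingExponents.


Section Extensions.
Variables (K : fieldType) (n : nat).
Hypothesis n3 : (2 < n)%N.
Implicit Types (i j k : 'I_n) (e f : nat * nat).

Lemma sum_delta_diag : \sum_k (delta_mx k k : 'M[{poly K}]_n) = 1%:M.
Proof.
apply/matrixP=> i j; rewrite summxE (bigD1 i) //= big1 => [|k /negPf ki]; last first.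
  by rewrite !mxE eq_sym ki.
by rewrite !mxE eqxx addr0 eq_sym.
Qed.

Lemma act_sum (M : lmod K n) : is_CM M -> \sum_k act M (delta_mx k k) = 1%:M.
Proof.
case=> mD mZ mM <-; rewrite -sum_delta_diag.
have m0 : act M 0 = 0 by rewrite -(scale0r (0 : 'M_n)) mZ scale0r.
by rewrite (big_morph (act M) mD m0).
Qed.

Lemma act_idem (M : lmod K n) i j : is_CM M ->
  act M (delta_mx i i) *m act M (delta_mx j j) = (i == j)%:R *: act M (delta_mx i i).
Proof.
case=> mD mZ mM _; rewrite -mM lam_mul_delta.
case: eqVneq => [<-|_]; last first.
  by rewrite scale0r -(scale0r (0 : 'M_n)) mZ scale0r.
by rewrite !ccoef_diag // expr0 !scale1r.
Qed.

(* Subtracting the inner derivation of [\sum_k e_k D(e_k)] kills every D(e_k). *)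
Lemma derivation_normalize (M N : lmod K n) D : is_CM M -> is_CM N -> @derivation K n M N D ->
  exists D', [/\ @derivation K n M N D', forall k, D' (delta_mx k k) = 0 & inner D' -> inner D].
Proof.
move=> cM cN [dD dZ dM]; have [mD mZ mM _] := cM; have [nD nZ nM _] := cN.
pose e k : 'M[{poly K}]_n := delta_mx k k.
have d0 : D 0 = 0 by rewrite -(scale0r (0 : 'M_n)) dZ scale0r.
pose H := \sum_k act N (e k) *m D (e k).
exists (fun A => D A - (act N A *m H - H *m act M A)); split.
- split=> [A B|q A|A B].
  + rewrite dD mD nD mulmxDl mulmxDr.
    move: (D A) (D B) (act N A *m H) (act N B *m H) (H *m act M A) (H *m act M B) => a b c c' g g'.
    by rewrite [X in _ - (_ + X)]opprD [c + c' + _]addrACA opprD addrACA.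
  + by rewrite dZ mZ nZ -scalemxAl -scalemxAr -!scalerBr.
  + rewrite dM mM nM !mulmxBr !mulmxBl !mulmxA.
    move: (_ *m D B) (D A *m _) (_ *m act N B *m H) (act N A *m H *m act M B) (H *m _ *m _) => a b c d h.
    by rewrite !opprB [RHS]addrACA; congr (_ + _); rewrite [RHS]addrC addrA subrK.
- move=> k.
  have eD : act N (e k) *m D (e k) *m act M (e k) = 0.
    have := dM (e k) (e k); rewrite lam_mul_delta eqxx !ccoef_diag // expr0 scale1r => /(congr1 (mulmx (act N (e k)))).
    rewrite mulmxDr !mulmxA act_idem // eqxx scale1r => /eqP.
    by rewrite -subr_eq0 opprD addNKr oppr_eq0 => /eqP.
  have eDj j : j != k -> act N (e j) *m D (e j) *m act M (e k) = - (act N (e j) *m D (e k)).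
    move=> jk; have := dM (e j) (e k); rewrite lam_mul_delta (negPf jk) d0 => /(congr1 (mulmx (act N (e j)))).
    rewrite mulmx0 mulmxDr !mulmxA act_idem // eqxx scale1r => /esym/eqP.
    by rewrite addrC addr_eq0 => /eqP.
  rewrite mulmx_sumr mulmx_suml (bigD1 k) //= big1 => [|j jk]; last first.
    by rewrite mulmxA act_idem // eq_sym (negPf jk) scale0r mul0mx.
  rewrite addr0 mulmxA act_idem // eqxx scale1r [X in _ - (_ - X)](bigD1 k) //= eD add0r.
  rewrite (eq_bigr (fun j => - (act N (e j) *m D (e k)))) => [|j jk]; last exact: eDj.
  have : \sum_j act N (e j) *m D (e k) = D (e k) by rewrite -mulmx_suml act_sum // mul1mx.
  by rewrite (bigD1 k) //= sumrN opprK => ->; rewrite subrr.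
- by case=> h eh; exists (h + H) => A; rewrite mulmxDr mulmxDl opprD addrACA -eh subrK.
Qed.

Lemma noncrossing_all_inner e f : edge n e -> edge n f -> ~~ cross e f ->
  all_inner (edge_mod K n e) (edge_mod K n f).
Proof.
move=> ee ef ncr D0 der0.
have cM := edge_mod_CM K n3 ee; have cN := edge_mod_CM K n3 ef.
have [D [[dD dZ dM] De]] := derivation_normalize cM cN der0; apply.
have {D0 der0} der : derivation D by [].
have [p gl] := noncrossing_glue n3 ee ef ncr.
pose d := @dexp n e.1 e.2; pose d' := @dexp n f.1 f.2.
have [st tn] := andP ee; have [st' tn'] := andP ef.
have dlt i j : (d i < ccoef i j + d j)%N by apply: dexp_lt.
have dlt' i j : (d' i < ccoef i j + d' j)%N by apply: dexp_lt.
have d2 i : (d i <= 2)%N by apply: dexp_le2.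
have cc3 i j : (ccoef i j <= 3)%N by rewrite /ccoef; do ![case: ifP].
pose q i j : {poly K} := D (delta_mx i j) i j.
(* Since D kills the idempotents, D(e_ij) = e_i D(e_ij) e_j has a single possibly nonzero entry. *)
have Dq i j : D (delta_mx i j) = q i j *: delta_mx i j.
  have cci (a b : 'I_n) : (ccoef a a + ccoef a b - (ccoef a b).+1 = 0)%N by have := ccoef_diag n3 a; lia.
  have ccj (a b : 'I_n) : (ccoef a b + ccoef b b - (ccoef a b).+1 = 0)%N by have := ccoef_diag n3 b; lia.
  have l : D (delta_mx i j) = delta_mx i i *m D (delta_mx i j).
    have := dM (delta_mx i i) (delta_mx i j).
    by rewrite lam_mul_delta eqxx cci scale1r De mul0mx addr0 /edge_mod act_st_idem.
  have r : D (delta_mx i j) = D (delta_mx i j) *m delta_mx j j.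
    have := dM (delta_mx i j) (delta_mx j j).
    by rewrite lam_mul_delta eqxx ccj scale1r De mulmx0 add0r /edge_mod act_st_idem.
  apply/matrixP=> a b; rewrite !mxE; case: eqVneq => [->|ai] /=; last first.
    rewrite mulr0 l mxE big1 // => k _; by rewrite mxE (negPf ai) mul0r.
  case: eqVneq => [->|bj] /=; rewrite ?mulr1 // mulr0 r mxE big1 // => k _.
  by rewrite mxE (negPf bj) andbF mulr0.
(* D is conjugation by diag(u) over K(x), and Y i j = x^4 (u_j - u_i). *)
pose Y i j := 'X^(5 + d' i - ccoef i j - d j) * q i j.
have Yadd i j k : Y i k = Y i j + Y j k.
  have := dM (delta_mx i j) (delta_mx j k).
  rewrite lam_mul_delta eqxx dZ !Dq /edge_mod !act_st_delta => /matrixP/(_ i k).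
  rewrite -!scalemxAl -!scalemxAr !mul_delta_mx !mxE !eqxx !mulr1 -/d -/d' => eq.
  (* [ccoef] is at most 3 and [dexp] at most 2, whence the 5 in [Y]; the factor x^3 makes room for a
     second [ccoef]. *)
  apply: (@mulfI _ 'X^3).
    by rewrite expf_neq0 ?polyX_eq0.
  have := (dlt j k, dlt' i j, d2 j, d2 k, cc3 i j, cc3 j k, cc3 i k, ccoef_triangle n3 i j k, dlt i k).
  case=> [[[[[[[[h1 h2] h3] h4] h5] h6] h7] h8] h9].
  pose E := (9 + d' i - ccoef i j - ccoef j k - d k)%N.
  transitivity ('X^E * ('X^(ccoef i j + ccoef j k - (ccoef i k).+1) * q i k)).
    by rewrite /Y !mulrA -!exprD; congr ('X^_ * _); rewrite /E; lia.
  rewrite eq mulrDr [RHS]mulrDr addrC /Y; congr (_ + _).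
    rewrite [q i j * _]mulrC !mulrA -!exprD; congr ('X^_ * _); rewrite /E; lia.
  by rewrite !mulrA -!exprD; congr ('X^_ * _); rewrite /E; lia.
have Y0 i : Y i i = 0 by rewrite /Y /q De mxE mulr0.
have Yopp i j : Y i j = - Y j i by apply/eqP; rewrite -addr_eq0 -Yadd Y0.
(* If i generates k, then c_ki + d_i = d_k, and u_k - u_i has exactly the divisibility by x^(d'_k -
   d_k) that a matrix over R requires. *)
have Ygood i k : generates e.1 e.2 i k -> 'X^(4 + d' k - d k) %| Y i k.
  rewrite /generates -/d => g; rewrite Yopp dvdpNr /Y dvdp_mulr // dvdp_exp2l //.
  by have := (cc3 k i, d2 i, d2 k) => -[[]]; lia.
have dvdX k : exists h, Y p k = 'X^(4 + d' k - d k) * h.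
  suff /dvdpP[h ->] : 'X^(4 + d' k - d k) %| Y p k by exists h; rewrite mulrC.
  have [/Ygood //|[p' [m [g1 g2 g3 le]]]] := gl k.
  have sub : ('X^(4 + d' k - d k) %| ('X^(4 + d' m - d m) : {poly K})).
    by apply: dvdp_exp2l; have := (d2 k, d2 m) => -[]; move: le; rewrite -/d -/d'; lia.
  rewrite (Yadd p m k) (Yadd m p' k) dvdp_add ?(dvdp_trans sub (Ygood _ _ g1)) //.
  by rewrite dvdp_add ?Ygood // Yopp dvdpNr (dvdp_trans sub (Ygood _ _ g2)).
(* Normalising u_p = 0, the entry h_k is u_k in the bases of the two modules, that is x^(d_k - d'_k)
   u_k. *)
have /fin_all_exists [h hh] := dvdX.
pose h' : 'M[{poly K}]_n := diag_mx (\row_k h k).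
apply: (@derivation_inner K n (edge_mod K n e) (edge_mod K n f) D h' cM cN der) => i j.
rewrite Dq /edge_mod !act_st_delta -!scalemxAl -!scalemxAr.
have -> : delta_mx i j *m h' = h j *: delta_mx i j.
  by apply/matrixP=> a b; rewrite mul_mx_diag !mxE; case: (b =P j) => [->|_]; rewrite ?andbF ?mul0r ?mulr0 // mulrC.
have -> : h' *m delta_mx i j = h i *: delta_mx i j.
  by apply/matrixP=> a b; rewrite mul_diag_mx !mxE; case: (a =P i) => [->|_]; rewrite ?mulr0.
rewrite !scalerA -scalerBl; congr (_ *: _).
apply: (@mulfI _ 'X^(5 + d' i - ccoef i j - d j)); first by rewrite expf_neq0 ?polyX_eq0.
rewrite -/(Y i j) mulrBr !mulrA -!exprD -/d -/d'.
have -> : Y i j = Y p j - Y p i by rewrite (Yadd p i j) addrC addKr.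
have := (cc3 i j, d2 i, d2 j, dlt i j, dlt' i j) => -[[[[h1 h2] h3] h4] h5].
by rewrite !hh; congr ('X^_ * _ - 'X^_ * _); rewrite -/d -/d'; lia.
Qed.

Lemma crossing_not_all_inner e f : edge n e -> edge n f -> cross e f ->
  ~ all_inner (edge_mod K n e) (edge_mod K n f).
Proof.
move=> ee ef cr inn.
have [Q [r [a [b [tight Qab [da db] [d'a d'b] cab]]]]] := crossing_cut n3 ee ef cr.
have [st tn] := andP ee; have [st' tn'] := andP ef.
pose d := @dexp n e.1 e.2; pose d' := @dexp n f.1 f.2.
have dlt i j : (d i < ccoef i j + d j)%N by apply: dexp_lt.
have dlt' i j : (d' i < ccoef i j + d' j)%N by apply: dexp_lt.
(* This is x^(r-1) (1_Q(j) - 1_Q(i)) in the bases of the two modules. Unshifted the exponent is c_ij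
   + d_j - d'_i + r - 1, which [tight] makes nonnegative wherever the difference of indicators is
   nonzero. *)
pose c i j : {poly K} := ((Q j)%:R - (Q i)%:R) * 'X^(ccoef i j + d j + r - (d' i).+2).
pose D (A : 'M[{poly K}]_n) : 'M[{poly K}]_n := \matrix_(i, j) (c i j * A i j).
have [|h eh] := inn D.
  split=> [A B|q A|A B]; apply/matrixP=> i j; rewrite !mxE; move: i j => /= i j.
  - by rewrite mulrDr.
  - by rewrite mulrCA.
  - rewrite mulr_sumr -big_split; apply: eq_bigr => k _; rewrite !mxE /=.
    rewrite -/d -/d' /c.
    have := (dlt k j, dlt' i k, ccoef_triangle n3 i k j) => -[[h1 h2] h3].
    have := (tight i j, tight i k, tight k j) => -[[]].
    rewrite -/d -/d'.
    have mx u v (x y : {poly K}) : 'X^u * x * ('X^v * y) = 'X^(u + v) * (x * y).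
      by rewrite exprD mulrACA.
    have ml u v (x y : {poly K}) : 'X^u * ('X^v * x * y) = 'X^(u + v) * (x * y).
      by rewrite exprD !mulrA.
    case: (Q i); case: (Q j); case: (Q k) => /= t1 t2 t3;
      rewrite ?subrr ?subr0 ?sub0r ?mul0r ?mulr0 ?mul0r ?add0r ?addr0 ?mul1r ?mulN1r //;
      rewrite ?(mulrN, mulNr) ?mx ?ml;
      try (apply/esym/eqP; rewrite ?[- _ + _]addrC subr_eq0; apply/eqP);
      try congr (- _); congr ('X^_ * _);
      try have {}t1 := t1 isT; try have {}t2 := t2 isT; try have {}t3 := t3 isT; lia.
have := eh (delta_mx a b); rewrite /edge_mod !act_st_delta -!scalemxAl -!scalemxAr.
move=> /matrixP/(_ a b); rewrite !mxE (bigD1 b) //= big1 => [|k /negPf kb]; last first.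
  by rewrite !mxE kb andbF mul0r.
rewrite (bigD1 a) //= big1 => [|k /negPf ka]; last by rewrite !mxE ka mulr0.
rewrite !mxE !eqxx !addr0 !mulr1 mul1r /c -/d -/d'.
have -> : (ccoef a b + d b + r - (d' a).+2 = (ccoef a b).-1)%N by rewrite /d /d' db d'a; lia.
have -> : (ccoef a b + d' b - (d' a).+1 = ccoef a b)%N by rewrite /d' d'b d'a; lia.
have -> : (ccoef a b + d b - (d a).+1 = ccoef a b)%N by rewrite /d db da; lia.
rewrite -mulrBr -(prednK cab) exprSr /= mulrC -mulrA => /mulfI; rewrite expf_neq0 ?polyX_eq0 //.
move=> /(_ isT) eX.
have : 'X %| ((Q b)%:R - (Q a)%:R : {poly K}) by rewrite eX dvdp_mulr.
have X1 : 'X %| (1 : {poly K}) = false.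
  by apply/negP => /dvdp_leq; rewrite oner_eq0 size_polyX size_poly1 => /(_ isT).
by move: Qab; case: (Q a); case: (Q b) => //= _; rewrite ?subr0 ?sub0r ?dvdpNr X1.
Qed.

End Extensions.


(** * Idempotent matrices over K[x] *)

Section PolynomialMatrices.
Variable K : fieldType.

Lemma elementary_mx_mul m (i j : 'I_m) (q : {poly K}) : i != j ->
  (1%:M + q *: delta_mx j i) *m (1%:M - q *: delta_mx j i) = 1%:M.
Proof.
move=> ij; rewrite mulmxDl !mulmxBr mulmx1 mul1mx mulmx1 -scalemxAl -scalemxAr.
by rewrite mul_delta_mx_cond (negPf ij) mulr0n !scaler0 subr0 subrK.
Qed.

(* Euclid's algorithm on the entries of a column. *)
Lemma column_reduction m (a : 'cV[{poly K}]_m.+1) :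
  exists U V : 'M[{poly K}]_m.+1,
    [/\ U *m V = 1%:M, V *m U = 1%:M & forall i, i != ord0 -> (U *m a) i 0 = 0].
Proof.
have [s] := ubnP (\sum_i size (a i 0%R))%N; elim: s => // s IH in a *; rewrite ltnS => les.
have [[i j] /andP[/andP[/= ij ai] /andP[aj leij]]|none] :=
    pickP (fun p : 'I_m.+1 * 'I_m.+1 => (p.1 != p.2) && (a p.1 0 != 0) &&
        ((a p.2 0 != 0) && (size (a p.1 0%R) <= size (a p.2 0%R))%N)).
  (* The larger of two nonzero entries is replaced by its remainder, which lowers the sum of sizes.
     Without such a pair at most one entry is nonzero, and a transposition moves it to the top. *)
  pose q := a j 0 %/ a i 0.
  pose E : 'M[{poly K}]_m.+1 := 1%:M - q *: delta_mx j i.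
  pose F : 'M[{poly K}]_m.+1 := 1%:M + q *: delta_mx j i.
  have FE : F *m E = 1%:M by apply: elementary_mx_mul.
  have EF : E *m F = 1%:M.
    by have := elementary_mx_mul (- q) ij; rewrite scaleNr opprK.
  have Ea k : (E *m a) k 0 = if k == j then a j 0 %% a i 0 else a k 0.
    rewrite mulmxBl mul1mx -scalemxAl !mxE (bigD1 i) //= big1 => [|l /negPf li]; last first.
      by rewrite mxE li andbF mul0r.
    rewrite mxE eqxx andbT addr0; case: eqVneq => [->|_]; last by rewrite mul0r mulr0 subr0.
    by rewrite mul1r {1}(divp_eq (a j 0) (a i 0)) -/q addrAC subrr add0r.
  have [|U [V [UV VU z]]] := IH (E *m a).
    apply: leq_trans les; rewrite [X in (X < _)%N](bigD1 j) //= [X in (_ < X)%N](bigD1 j) //=.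
    rewrite Ea eqxx -addSn leq_add //.
      by apply: leq_trans leij; rewrite ltn_modp.
    by rewrite leq_eqVlt (eq_bigr (fun k => size (a k 0))) ?eqxx // => k /negPf kj; rewrite Ea kj.
  exists (U *m E), (F *m V); split.
  - by rewrite mulmxA -(mulmxA U) EF mulmx1.
  - by rewrite mulmxA -(mulmxA F) VU mulmx1.
  - by move=> k k0; rewrite -mulmxA z.
have [i ai|zero] := pickP (fun i => a i 0 != 0); last first.
  exists 1%:M, 1%:M; rewrite mulmx1; split=> // i _.
  by rewrite mul1mx; have /eqP := zero i.
have a0 k : k != i -> a k 0 = 0.
  move=> ki; apply/eqP/negPn/negP => ak.
  have [l|/ltnW l] := leqP (size (a i 0)) (size (a k 0)).
    by have := none (i, k); rewrite /= eq_sym ki ai ak l.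
  by have := none (k, i); rewrite /= ki ai ak l.
exists (tperm_mx ord0 i), (tperm_mx ord0 i); split.
- by rewrite -perm_mxM tperm2 perm_mx1.
- by rewrite -perm_mxM tperm2 perm_mx1.
- move=> k k0; rewrite -row_permE mxE a0 //.
  by apply: contraNneq k0 => e; rewrite -(tpermK ord0 i k) e tpermR.
Qed.

(** This is a row echelon form: [B] consists of the nonzero rows, and [C] of columns of an
    invertible matrix, which gives its left inverse [D]. *)
Lemma matrix_factorization n m (A : 'M[{poly K}]_(m, n)) :
  exists r (C : 'M[{poly K}]_(m, r)) (D : 'M_(r, m)) (B : 'M_(r, n)),
    [/\ A = C *m B, D *m C = 1%:M & forall w : 'rV_r, w *m B = 0 -> w = 0].
Proof.
elim: n m A => [|n IH] m A.
  exists 0%N, 0, 0, 0; split=> [||w _].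
  - by rewrite mulmx0; apply/matrixP=> i [].
  - by apply/matrixP=> -[].
  - by apply/matrixP=> i [].
case: m A => [|m] A.
  exists 0%N, 0, 0, 0; split=> [||w _].
  - by apply/matrixP=> -[].
  - by apply/matrixP=> -[].
  - by apply/matrixP=> i [].
move: A; rewrite -[n.+1]/(1 + n)%N -[m.+1]/(1 + m)%N => A.
rewrite -[A]hsubmxK; set a := lsubmx _; set A' := rsubmx _.
have [a0|an0] := eqVneq a 0.
  have [r [C [D [B [-> DC inj]]]]] := IH _ A'.
  exists r, C, D, (row_mx 0 B); split=> // [|w]; first by rewrite mul_mx_row mulmx0 a0.
  by rewrite mul_mx_row => /(congr1 rsubmx); rewrite row_mxKr linear0 => /inj.
have [U [V [UV VU z]]] : exists U V : 'M[{poly K}]_(1 + m), [/\ U *m V = 1%:M, V *m U = 1%:M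
    & forall i, i != ord0 -> (U *m a) i 0 = 0] by exact: (@column_reduction m a).
pose A1 : 'M[{poly K}]_(1 + m, 1 + n) := U *m row_mx a A'.
have dl0 : dlsubmx A1 = 0.
  apply/matrixP=> i j; rewrite /dlsubmx mxE mxE /A1 mul_mx_row row_mxEl [j]ord1 [RHS]mxE.
  exact: (z (rshift 1 i)).
have [r [C [D [B [e DC inj]]]]] := IH _ (drsubmx A1).
pose g := ulsubmx A1 0 0.
have gn0 : g != 0.
  apply: contraNneq an0 => g0; rewrite -[a]mul1mx -VU -mulmxA.
  suff -> : U *m a = 0 by rewrite mulmx0.
  apply/matrixP=> i j; rewrite [j]ord1 [RHS]mxE; have [->|/z //] := eqVneq i ord0.
  rewrite -g0 /g /ulsubmx [RHS]mxE [RHS]mxE /A1 mul_mx_row row_mxEl.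
  by congr ((U *m a) _ _); apply: val_inj.
exists (1 + r)%N, (V *m block_mx 1%:M 0 0 C), (block_mx 1%:M 0 0 D *m U),
   (block_mx (ulsubmx A1) (ursubmx A1) 0 B); split.
- rewrite -mulmxA mulmx_block !mul1mx !mul0mx mulmx0 !addr0 add0r -e -dl0 submxK.
  by rewrite /A1 mulmxA VU mul1mx.
- rewrite mulmxA -(mulmxA _ U V) UV mulmx1 mulmx_block !mul1mx !mul0mx !mulmx0 !addr0 add0r DC.
  by rewrite -scalar_mx_block.
- move=> w; rewrite -[w]hsubmxK mul_row_block mulmx0 addr0 => ew.
  have := congr1 lsubmx ew; rewrite row_mxKl linear0 => /matrixP/(_ 0 0).
  rewrite mxE big_ord1 [X in _ = X]mxE -/g => /eqP; rewrite mulf_eq0 (negPf gn0) orbF => /eqP w0.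
  have wl : lsubmx w = 0 by apply/matrixP=> i j; rewrite [i]ord1 [j]ord1 w0 mxE.
  have := congr1 rsubmx ew; rewrite row_mxKr linear0 wl mul0mx add0r => /inj ->.
  by rewrite row_mx0.
Qed.

(** The image of an idempotent over K[x] is free. Cancelling C on the left in CBCB = CB gives BCB =
    B, and the independent rows of B then give BC = 1. *)
Lemma idempotent_split m (e : 'M[{poly K}]_m) : e *m e = e ->
  exists r (C : 'M[{poly K}]_(m, r)) (B : 'M_(r, m)), e = C *m B /\ B *m C = 1%:M.
Proof.
move=> ee; have [r [C [D [B [eCB DC inj]]]]] := matrix_factorization e.
exists r, C, B; split=> //.
have BCB : (B *m C - 1%:M) *m B = 0.
  have : D *m (C *m B *m (C *m B)) = D *m (C *m B) by rewrite -eCB ee.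
  by rewrite !mulmxA DC !mul1mx mulmxBl mul1mx => ->; rewrite subrr.
apply/eqP; rewrite -subr_eq0; apply/eqP/row_matrixP=> i.
by rewrite row0; apply: inj; rewrite -row_mul BCB row0.
Qed.

End PolynomialMatrices.

Section Complements.
Variables (K : fieldType) (n : nat).

(** The complement is the image of 1 - i p; splitting this idempotent provides the basis that a
    module must carry. *)
Lemma summand_complement (X M : lmod K n) : is_CM M -> summand X M ->
  exists N, is_CM N /\ iso M (dsum X N).
Proof.
move=> cM [i [p [hi hp pi]]].
have [|r [C [B [eCB BC]]]] := idempotent_split (e := 1%:M - i *m p).
  rewrite mulmxBr mulmx1 mulmxBl mul1mx -(mulmxA i p) (mulmxA p i) pi mul1mx.
  by rewrite subrr subr0.
pose N := @LMod K n r (fun A => B *m act M A *m C).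
have hip : hom M M (1%:M - i *m p).
  by apply: hom_sub; [exact: hom_id | exact: hom_comp hp hi].
have hC : hom N M C.
  by move=> A; rewrite /= !mulmxA -eCB hip -mulmxA eCB -mulmxA BC mulmx1.
have hB : hom M N B.
  by move=> A; rewrite /= -mulmxA -eCB -mulmxA -hip eCB !mulmxA BC mul1mx.
have pC : p *m C = 0.
  by rewrite -[C]mulmx1 -BC !mulmxA -(mulmxA p) -eCB mulmxBr mulmx1 mulmxA pi mul1mx subrr mul0mx.
have Bi : B *m i = 0.
  by rewrite -[B]mul1mx -BC -!mulmxA (mulmxA C) -eCB mulmxBl mul1mx -mulmxA pi mulmx1 subrr mulmx0.
exists N; split; first by apply: summand_CM cM _; exists C, B.
apply: (@biproduct_iso K n M X N i C p B); split; split=> //.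
by rewrite -eCB addrC subrK.
Qed.

End Complements.


(** * Decomposition of Cohen-Macaulay modules *)

Section Evaluation.
Variable K : fieldType.

Definition eval0 p q (A : 'M[{poly K}]_(p, q)) : 'M[K]_(p, q) := map_mx (horner_eval 0) A.

Definition const p q (A : 'M[K]_(p, q)) : 'M[{poly K}]_(p, q) := map_mx polyC A.

Lemma eval0M p q m (A : 'M[{poly K}]_(p, q)) (B : 'M_(q, m)) :
  eval0 (A *m B) = eval0 A *m eval0 B.
Proof. exact: map_mxM. Qed.

Lemma eval0B p q (A B : 'M[{poly K}]_(p, q)) : eval0 (A - B) = eval0 A - eval0 B.
Proof. exact: map_mxB. Qed.

Lemma eval01 p : eval0 (1%:M : 'M[{poly K}]_p) = 1%:M.
Proof. exact: map_mx1. Qed.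

Lemma eval0_const p q (A : 'M[K]_(p, q)) : eval0 (const A) = A.
Proof. by apply/matrixP=> i j; rewrite !mxE /horner_eval hornerC. Qed.

Lemma eval0_scaleX p q (A : 'M[{poly K}]_(p, q)) : eval0 ('X *: A) = 0.
Proof. by apply/matrixP=> i j; rewrite !mxE /horner_eval hornerM hornerX mul0r. Qed.

Lemma eval0_eq0 p q (A : 'M[{poly K}]_(p, q)) : eval0 A = 0 -> exists A', A = 'X *: A'.
Proof.
move=> /matrixP eA; exists (map_mx (fun f => f %/ 'X) A); apply/matrixP=> i j.
rewrite !mxE mulrC divpK // -['X]subr0 -polyC0 dvdp_XsubCl.
by have := eA i j; rewrite !mxE /root => /eqP.
Qed.

End Evaluation.

Section Classification.
Variables (K : fieldType) (n : nat).
Hypothesis n3 : (2 < n)%N.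
Implicit Types (i j k : 'I_n) (e : nat * nat).

Let o : 'I_n := Ordinal (ltn_trans (ltn0Sn 1) n3).

Lemma scaleX_inj m p (a : nat) (A B : 'M[{poly K}]_(m, p)) :
  'X^a *: A = 'X^a *: B -> A = B.
Proof.
move=> /matrixP eAB; apply/matrixP=> i j; have := eAB i j; rewrite !mxE.
by apply: mulfI; rewrite expf_neq0 ?polyX_eq0.
Qed.

(** Hence the exponent 1 - [ccoef o j] used in [lattice] is -c_1j: it is 0, except for 1 at the last
    vertex, which places L_n inside x L_1. *)
Lemma ccoef_first_le1 j : (ccoef o j <= 1)%N.
Proof. by rewrite /ccoef leq0n; case: ifP. Qed.

Section SplitFirstVertex.
Variables (M : lmod K n) (r : nat).
Variables (C : 'M[{poly K}]_(rk M, r)) (B : 'M[{poly K}]_(r, rk M)).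
Hypotheses (cM : is_CM M) (eCB : act M (delta_mx o o) = C *m B) (BC : B *m C = 1%:M).

Let act_delta i j : 'M_(rk M) := act M (delta_mx i j).

Lemma act_delta_mul i j k l : act_delta i j *m act_delta k l =
  (if j == k then 'X^(ccoef i j + ccoef j l - (ccoef i l).+1) else 0) *: act_delta i l.
Proof.
have [mD mZ mM _] := cM; rewrite /act_delta -mM lam_mul_delta.
by case: ifP => _; rewrite ?mZ // scale0r -(scale0r (0 : 'M_n)) mZ scale0r.
Qed.

(* The column space of [lattice j] is the image L_j of e_j M in L_1 = e_1 M = R^r. *)
Definition lattice j : 'M[{poly K}]_(r, rk M) := 'X^(1 - ccoef o j) *: (B *m act_delta o j).

(** This is E_1i (x^(c_ij) E_ij) = x^(c_ij) E_1j for matrix units E, multiplied by x because c_1n =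
    -1. *)
Lemma lattice_act i j : 'X *: (lattice i *m act_delta i j) = 'X^(ccoef i j) *: lattice j.
Proof.
rewrite /lattice -!scalemxAl -mulmxA act_delta_mul eqxx -scalemxAr !scalerA -exprS -!exprD.
congr ('X^_ *: _).
by have := (ccoef_triangle n3 o i j, ccoef_first_le1 i, ccoef_first_le1 j) => -[[]]; lia.
Qed.

Lemma lattice_act0 i j k : k != i -> lattice k *m act_delta i j = 0.
Proof.
move=> ki; rewrite /lattice -!scalemxAl -mulmxA act_delta_mul (negPf ki).
by rewrite scale0r mulmx0 scaler0.
Qed.

(** The map e_i M -> L_1 is injective: returning from vertex 1 to i multiplies by a power of x, and
    M is torsion-free. *)
Lemma lattice_inj p i (Y Z : 'M_(rk M, p)) :
  lattice i *m (act_delta i i *m Y) = lattice i *m (act_delta i i *m Z) ->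
  act_delta i i *m Y = act_delta i i *m Z.
Proof.
rewrite /lattice -!scalemxAl => /scaleX_inj/(congr1 (mulmx C)).
rewrite !mulmxA -eCB -/(act_delta o o) act_delta_mul eqxx -!scalemxAl => /scaleX_inj.
rewrite act_delta_mul eqxx -!scalemxAl => /scaleX_inj/(congr1 (mulmx (act_delta i o))).
by rewrite !mulmxA act_delta_mul eqxx -!scalemxAl => /scaleX_inj.
Qed.

Lemma lattice_first : lattice o = B.
Proof.
by rewrite /lattice ccoef_diag // subnn expr0 scale1r /act_delta eCB mulmxA BC mul1mx.
Qed.

Lemma lattice_sub i j : (0 < ccoef i j)%N ->
  'X^((ccoef i j).-1) *: lattice j = lattice i *m act_delta i j.
Proof.
move=> c; apply: (@scaleX_inj _ _ 1); rewrite scalerA -exprD add1n prednK // expr1.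
by rewrite lattice_act.
Qed.

Lemma lattice_split j : lattice j *m act_delta j j = lattice j.
Proof.
by apply: (@scaleX_inj _ _ 1); rewrite expr1 lattice_act ccoef_diag // expr1.
Qed.

Lemma lattice_X2 i : exists Y, 'X^2 *: 1%:M = lattice i *m Y.
Proof.
have c3 : (0 < ccoef i o <= 3)%N by rewrite /ccoef; do ![case: ifPn] => //=; lia.
exists ('X^(3 - ccoef i o) *: (act_delta i o *m C)).
rewrite -scalemxAr mulmxA -lattice_sub ?(andP c3).1 // -scalemxAl lattice_first BC scalerA -exprD.
by congr ('X^_ *: _); lia.
Qed.

(** The vector [w] spans a copy of (s,t), embedded by sending the j-th basis vector to the element
    of e_j M lying over x^(d_j) w; the retraction is x^(-d_j) l on L_j. *)
Lemma edge_summand_of_vector e (w : 'cV_r) (l : 'rV_r) : edge n e ->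
  (forall j, exists u, 'X^(dexp e.1 e.2 j) *: w = lattice j *m u) ->
  (forall j, exists p, l *m lattice j = 'X^(dexp e.1 e.2 j) *: p) ->
  l *m w = 1%:M -> summand (edge_mod K n e) M.
Proof.
move=> ee /fin_all_exists[u eu] /fin_all_exists[p ep] lw.
have [st tn] := andP ee.
pose d := @dexp n e.1 e.2.
have dlt i j : (d i < ccoef i j + d j)%N by apply: dexp_lt.
(* The preimage [u j] is projected to e_j M, where [lattice_inj] makes it unique and hence
   compatible with the action. *)
pose F : 'M[{poly K}]_(rk M, n) := \matrix_(i, j) (act_delta j j *m u j) i 0.
pose P : 'M[{poly K}]_(n, rk M) := \matrix_(i, j) p i 0 j.
have colF j : col j F = act_delta j j *m u j.
  by apply/colP=> i; rewrite !mxE.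
have rowP' i : row i P = p i by apply/rowP=> j; rewrite !mxE.
have cE := edge_mod_CM K n3 ee.
have hF : hom (edge_mod K n e) M F.
  apply: is_hom_delta => // i j; rewrite /edge_mod act_st_delta -/d -scalemxAr.
  have col_mul m (A : 'M[{poly K}]_(m, n)) k : col k (A *m delta_mx i j) = (k == j)%:R *: col i A.
    by rewrite colE -mulmxA mul_delta_mx_cond; case: eqVneq => _; rewrite ?mulr1n ?scale1r -?colE // mulr0n mulmx0 scale0r.
  apply/matrixP=> a k.
  have -> (A : 'M[{poly K}]_(rk M, n)) : A a k = col k A a 0 by rewrite mxE.
  have -> (A : 'M[{poly K}]_(rk M, n)) : A a k = col k A a 0 by rewrite mxE.
  congr (fun_of_matrix _ a 0); rewrite linearZ /= col_mul colF -/(act_delta i j) mulmx_col colF mulmxA act_delta_mul.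
  rewrite eq_sym; case: eqVneq => [<-|_]; last by rewrite !scale0r scaler0 mul0mx.
  rewrite scale1r -scalemxAl -[act_delta i j]mul1mx.
  have -> : (ccoef i j + ccoef j j - (ccoef i j).+1 = 0)%N by rewrite (ccoef_diag n3 j); lia.
  have aij : act_delta i j = act_delta i i *m act_delta i j.
    by rewrite act_delta_mul eqxx (ccoef_diag n3 i) add1n subnn expr0 scale1r.
  rewrite expr0 scale1r mul1mx aij -mulmxA scalemxAr; apply: lattice_inj.
  rewrite !mulmxA lattice_split -scalemxAr -eu; apply: (@scaleX_inj _ _ 1).
  rewrite expr1 -[lattice i *m _ *m u j]scale1r [_ *: (1 *: _)]scalerA mulr1 scalemxAl lattice_act.
  rewrite -scalemxAl -eu !scalerA -exprS -!exprD; congr ('X^_ *: _).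
  by have := dlt i j; rewrite /d; lia.
have hP : hom M (edge_mod K n e) P.
  apply: is_hom_delta => // i j; rewrite /edge_mod act_st_delta -/d -scalemxAl -/(act_delta i j).
  apply/row_matrixP=> k; rewrite row_mul rowP'.
  have -> : row k ('X^(ccoef i j + d j - (d i).+1) *: (delta_mx i j *m P)) =
            'X^(ccoef i j + d j - (d i).+1) *: ((k == i)%:R *: p j).
    rewrite linearZ /= row_mul; congr (_ *: _).
    rewrite -rowP' [row j P]rowE scalemxAl; congr (_ *m _).
    by apply/rowP=> a; rewrite !mxE; case: (k == i) => /=; rewrite ?mul1r ?mul0r.
  case: eqVneq => [->|ki].
    apply: (@scaleX_inj _ _ (d i).+1); rewrite scale1r scalerA -exprD.
    rewrite exprS -scalerA scalemxAl -ep -mulmxA scalemxAr lattice_act -scalemxAr ep scalerA -exprD.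
    by congr ('X^_ *: _); have := dlt i j; rewrite /d; lia.
  apply: (@scaleX_inj _ _ (d k)); rewrite scale0r !scaler0 scalemxAl -ep -mulmxA.
  by rewrite lattice_act0 // mulmx0.
exists F, P; split=> //.
have hPF := hom_comp hF hP.
(* An endomorphism of (s,t) is a scalar, so its entry at vertex [o], which is l w, suffices. *)
rewrite (edge_end_scalar n3 ee hPF) -/o; congr (_%:M).
have -> : (P *m F) o o = (p o *m (act_delta o o *m u o)) 0 0.
  by rewrite -rowP' -colF !mxE; apply: eq_bigr => k _; rewrite !mxE.
have do0 : dexp e.1 e.2 o = 0%N by rewrite dexp_first //; lia.
have po : p o = l *m lattice o by rewrite ep do0 expr0 scale1r.
rewrite po mulmxA -[l *m _ *m _]mulmxA lattice_split -mulmxA -eu do0 expr0 scale1r lw.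
by rewrite mxE eqxx.
Qed.

Lemma exists_edge_summand : (0 < r)%N -> exists2 e, edge n e & summand (edge_mod K n e) M.
Proof.
move=> r0.
have evo : eval0 (lattice o) != 0.
  apply: contraTneq isT => e0; have := congr1 (@eval0 K _ _) BC.
  rewrite -lattice_first eval0M e0 mul0mx eval01 => /matrixP/(_ (Ordinal r0) (Ordinal r0)).
  by rewrite !mxE eqxx => /esym/eqP; rewrite oner_eq0.
pose inL j (y : 'cV_r) := exists u, y = lattice j *m u.
have inLX j y : inL j ('X^2 *: y).
  by have [Y eY] := lattice_X2 j; exists (Y *m y); rewrite mulmxA -eY -scalemxAl mul1mx.
have inLD j y z : inL j y -> inL j z -> inL j (y + z).
  by move=> [u ->] [u' ->]; exists (u + u'); rewrite mulmxDr.
have inLZ j q y : inL j y -> inL j (q *: y).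
  by move=> [u ->]; exists (q *: u); rewrite scalemxAr.
have inLS i j y : ccoef i j = 1%N -> inL j y -> inL i y.
  move=> c1 [u ->]; exists (act_delta i j *m u).
  by rewrite mulmxA -lattice_sub c1 // expr0 scale1r.
pose S (j : 'I_n) := eval0 (lattice j) != 0.
case: (@arg_maxnP _ o S (fun j : 'I_n => j : nat) evo) => s evs smax.
have bigs j : (s < j)%N -> exists H, lattice j = 'X *: H.
  move=> sj; apply/eval0_eq0/eqP; apply: contraLR sj => /smax; rewrite -leqNgt; exact.
(* L_n lies in x L_1 because c_1n = -1, so s is not the last vertex. *)
have sn : (s.+1 < n)%N.
  rewrite ltn_neqAle ltn_ord andbT; apply: contraNneq evs => es.
  have cs : ccoef o s = 0%N by rewrite /ccoef /=; case: eqVneq => // /eqP; lia.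
  by rewrite /lattice cs subn0 expr1 eval0_scaleX.
have /fin_all_exists[H eH] : forall j, exists H, (s < j)%N -> lattice j = 'X *: H.
  move=> j; case: (boolP (s < j)%N) => [/bigs[H ->]|]; last by exists 0.
  by exists H.
have [a wk] : exists a, col a (eval0 (lattice s)) != 0.
  apply/existsP; apply: contraNT evs; rewrite negb_exists => /forallP z.
  apply/eqP/matrixP=> i a; have := z a; rewrite negbK => /eqP/colP/(_ i).
  by rewrite mxE => ->; rewrite !mxE.
pose w0 := col a (lattice s); pose v := eval0 w0.
have w0s : inL s w0 by exists (delta_mx a 0); rewrite -colE.
have vn0 : v != 0 by rewrite /v /w0 /eval0 map_col.
(* For j > s one has L_j = x H_j, and L_j contains x^2 L_1; so x w0 lies in L_j as soon as [v] lies
   in the column space of H_j at x = 0. The transposes turn columns into the row spaces compared by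
   [<=]. *)
pose T := fun j : 'I_n => (s < j)%N && (v^T <= (eval0 (H j))^T)%MS.
pose s1 := Ordinal sn.
have Ts1 : T s1.
  rewrite /T /= ltnSn /=; have c2 : ccoef s1 s = 2%N by rewrite /ccoef /= ltnn eqxx.
  have := @lattice_sub s1 s; rewrite c2 => /(_ isT) es; have [u eu] := w0s.
  have e1 : w0 = H s1 *m (act_delta s1 s *m u).
    apply: (@scaleX_inj _ _ 1); rewrite eu scalemxAl es eH ?ltnSn // expr1.
    by rewrite -!scalemxAl mulmxA.
  by rewrite /v e1 eval0M trmx_mul submxMl.
case: (@arg_maxnP _ s1 T (fun j : 'I_n => j : nat) Ts1) => t /andP[st /submxP[z ez]] tmax.
have Xw0t : inL t ('X *: w0).
  have ev : v = eval0 (H t) *m z^T by rewrite -[v]trmxK ez trmx_mul trmxK.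
  have [|y ey] := @eval0_eq0 _ _ _ (w0 - H t *m const z^T).
    by rewrite eval0B eval0M eval0_const -ev subrr.
  have -> : w0 = H t *m const z^T + 'X *: y by rewrite -ey addrC subrK.
  rewrite scalerDr scalerA -expr2 scalemxAl -eH //; apply: inLD => //.
  by exists (const z^T).
(* The fibre of H at t+1 contains those at all later vertices and, by maximality of t, misses [v];
   the zero space serves if t is the last vertex. *)
have [Hx vHx jHx] : exists2 Hx : 'M[K]_(r, rk M), ~~ (v^T <= Hx^T)%MS &
    forall j, (t < j)%N -> ((eval0 (H j))^T <= Hx^T)%MS.
  have [tn|nt] := ltnP t.+1 n; last first.
    exists 0 => [|j tj]; first by rewrite trmx0; apply: contraNN vn0 => /submx0null/eqP; rewrite trmx_eq0.
    by have := ltn_ord j; lia.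
  pose t1 := Ordinal tn.
  exists (eval0 (H t1)) => [|j tj].
    apply/negP => vt; have := tmax t1; rewrite /T vt /= andbT ltnW // => /(_ isT).
    by rewrite ltnn.
  have c1 : ccoef t1 j = 1%N by rewrite /ccoef /= tj.
  have := @lattice_sub t1 j; rewrite c1 => /(_ isT); rewrite expr0 scale1r => es.
  have -> : H j = H t1 *m act_delta t1 j.
    apply: (@scaleX_inj _ _ 1); rewrite expr1 scalemxAl -!eH //; last exact: ltn_trans tj.
    by rewrite ltnW.
  by rewrite eval0M trmx_mul submxMl.
(* A column of the cokernel is a functional that kills [Hx] but not [v]. Rescaled and lifted to
   constants it becomes [l], which maps L_j into x^2 R for j > t. *)
have [b cb] : exists b, (v^T *m cokermx Hx^T) 0 b != 0.
  apply/existsP; apply: contraNT vHx; rewrite negb_exists submxE => /forallP zz.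
  by apply/eqP/rowP=> i; rewrite [RHS]mxE; apply/eqP; have := zz i; rewrite negbK.
pose c := (v^T *m cokermx Hx^T) 0 b.
pose lK : 'rV[K]_r := c^-1 *: (col b (cokermx Hx^T))^T.
have lKv : lK *m v = 1%:M.
  rewrite -scalemxAl -[v]trmxK -trmx_mul -mulmx_col.
  by apply/matrixP=> i j; rewrite [i]ord1 [j]ord1 [RHS]mxE eqxx 3!mxE -/c mulVf.
have lKH j : (t < j)%N -> lK *m eval0 (H j) = 0.
  move=> /jHx; rewrite submxE => /eqP e0.
  by rewrite -scalemxAl -[eval0 (H j)]trmxK -trmx_mul -mulmx_col e0 col0 trmx0 scaler0.
pose l := const lK.
have [|Q eQ] := @eval0_eq0 _ _ _ (l *m w0 - 1%:M).
  by rewrite eval0B eval0M eval01 eval0_const lKv subrr.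
pose q := Q 0 0.
(* As [l w0 = 1 + x q], this correction by an element of [x^2 L_1] makes [l w = 1]. *)
pose w := (1 - 'X * q) *: w0 + ('X^2 * q ^+ 2) *: const v.
have lw : l *m w = 1%:M.
  have e1 : l *m w0 = 1%:M + 'X *: Q by rewrite -eQ addrC subrK.
  have e2 : l *m const v = 1%:M by rewrite /const -map_mxM lKv map_mx1.
  rewrite mulmxDr -!scalemxAr e1 e2; apply/matrixP=> i j; rewrite [i]ord1 [j]ord1 !mxE -/q eqxx /=.
  by ring.
have inLw j q' : inL j (q' *: w0) -> inL j (q' *: w).
  move=> h; rewrite scalerDr scalerA [q' * (1 - _)]mulrC; apply: inLD.
    by rewrite -scalerA; apply: inLZ.
  by rewrite scalerA mulrCA -scalerA; apply: inLX.
(* Here s and t are the last 0-based vertices with exponent 0 and 1, hence the successors. *)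
exists (s.+1, t.+1); first by rewrite /edge /= ltnS st ltn_ord.
apply: (edge_summand_of_vector _ (w := w) (l := l)) => // [|j|j].
- by rewrite /edge /= ltnS st ltn_ord.
- rewrite -/(inL j _); apply: inLw; rewrite /dexp /= !ltnS.
  case: leqP => js.
    rewrite expr0 scale1r; apply: inLS w0s.
    by rewrite /ccoef js; case: ifP => // /andP[_ /eqP]; lia.
  case: leqP => jt; last exact: inLX.
  rewrite expr1; apply: inLS Xw0t.
  by rewrite /ccoef jt; case: ifP => // /andP[/eqP]; lia.
- rewrite /dexp /= !ltnS; case: leqP => js.
    by exists (l *m lattice j); rewrite expr0 scale1r.
  case: leqP => jt; first by exists (l *m H j); rewrite eH // scalemxAr expr1.
  have [|p ep] := @eval0_eq0 _ _ _ (l *m H j).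
    by rewrite eval0M eval0_const lKH.
  by exists p; rewrite eH // -scalemxAr ep scalerA -expr2.
Qed.

End SplitFirstVertex.
Lemma edge_summand_exists (M : lmod K n) : is_CM M -> (0 < rk M)%N ->
  exists2 e, edge n e & summand (edge_mod K n e) M.
Proof.
move=> cM rM.
have [|r [C [B [eCB BC]]]] := idempotent_split (e := act M (delta_mx o o)).
  by rewrite act_idem // eqxx scale1r.
apply: (exists_edge_summand cM eCB BC); rewrite lt0n; apply: contraTneq rM => r0.
(* If e_1 acts as zero, so does every e_k, because a power of x times e_k factors through vertex 1;
   then the identity of M vanishes. *)
have aoo : act M (delta_mx o o) = 0.
  rewrite eCB; apply/matrixP=> i j; rewrite !mxE big1 // => k _.
  by have := ltn_ord k; rewrite [X in (_ < X)%N]r0.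
have akk k : act M (delta_mx k k) = 0.
  have ako : act M (delta_mx k o) = 0.
    have := act_delta_mul cM k o o o; rewrite aoo mulmx0 eqxx => e0.
    by apply: (@scaleX_inj _ _ (ccoef k o + ccoef o o - (ccoef k o).+1)); rewrite scaler0 e0.
  have := act_delta_mul cM k o o k; rewrite ako mul0mx eqxx => e0.
  by apply: (@scaleX_inj _ _ (ccoef k o + ccoef o k - (ccoef k k).+1)); rewrite scaler0 e0.
have := act_sum cM; rewrite big1 // => e1; rewrite lt0n negbK; move: e1.
case: (rk M) => // m /matrixP/(_ ord0 ord0); rewrite !mxE => /esym/eqP.
by rewrite oner_eq0.
Qed.

Lemma dsum_rk0r (X Y : lmod K n) : rk Y = 0%N -> iso (dsum X Y) X.
Proof.
move=> r0; have [[hi1 _ hp1 _] [pi1 _ _ _ ip]] := dsum_biproduct X Y.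
exists (row_mx 1%:M 0), (col_mx 1%:M 0); split=> //; move: ip.
rewrite [X in _ + X](_ : _ = 0) ?addr0 //; apply/matrixP=> i j; rewrite mxE [RHS]mxE big1 // => k _.
by have := ltn_ord k; rewrite [X in (_ < X)%N]r0.
Qed.

Lemma dsum_rk0l (X Y : lmod K n) : rk X = 0%N -> iso (dsum X Y) Y.
Proof.
move=> r0; have [[_ hi2 _ hp2] [_ pi2 _ _ ip]] := dsum_biproduct X Y.
exists (row_mx 0 1%:M), (col_mx 0 1%:M); split=> //; move: ip.
rewrite [X in X + _](_ : _ = 0) ?add0r //; apply/matrixP=> i j; rewrite mxE [RHS]mxE big1 // => k _.
by have := ltn_ord k; rewrite [X in (_ < X)%N]r0.
Qed.

Lemma iso_rk0 (X Y : lmod K n) : rk X = 0%N -> rk Y = 0%N -> iso X Y.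
Proof.
by move=> x0 y0; exact: iso_trans (iso_sym (dsum_rk0r X y0)) (dsum_rk0l Y x0).
Qed.

Lemma CM_classification (M : lmod K n) : is_CM M ->
  exists2 s, all (edge n) s & iso M (dsum_list (map (edge_mod K n) s)).
Proof.
have [m] := ubnP (rk M); elim: m => // m IH in M *; rewrite ltnS => leM cM.
have [r0|rM] := posnP (rk M); first by exists [::] => //; apply: iso_rk0.
have [e ee se] := edge_summand_exists cM rM.
have [N [cN isoM]] := summand_complement cM se.
have [|s es isoN] := IH N _ cN.
  by apply: leq_trans leM; rewrite (iso_rk isoM) /= -[X in (X < _)%N]add0n ltn_add2r; lia.
exists (e :: s); first by rewrite /= ee.
by apply: iso_trans isoM _; apply: dsum_iso => //; apply: iso_refl.
Qed.

Lemma indecomposable_CM (X : lmod K n) : is_CM X -> indecomposable X ->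
  exists2 e, edge n e & iso X (edge_mod K n e).
Proof.
move=> cX [rX ind]; have [e ee se] := edge_summand_exists cX rX.
have [N [cN isoX]] := summand_complement cX se; exists e => //.
have [/= n0|N0] := ind _ _ isoX; first by lia.
exact: iso_trans isoX (dsum_rk0r _ N0).
Qed.

Lemma indecomposable_in_add (X T : lmod K n) : indecomposable X -> in_add T X -> summand X T.
Proof.
case=> rX ind [s [sT isoX]]; elim: s sT isoX => [|x s IH] sT isoX.
  by have := iso_rk isoX; rewrite /=; lia.
have [x0|s0] := ind _ _ isoX.
  apply: IH; first by move=> i; apply: (sT i.+1).
  exact: iso_trans isoX (dsum_rk0l _ x0).
exact: summand_trans (iso_summand (iso_trans isoX (dsum_rk0r x s0))) (sT 0%N isT).
Qed.

End Classification.


(** * Triangulations and cluster tilting objects *)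

Section Triangulations.
Variable n : nat.
Hypothesis n3 : (2 < n)%N.
Implicit Types (e f : nat * nat) (d : 'I_n * 'I_n) (sigma : {set 'I_n * 'I_n}).

Definition side e : bool := (e.2 == e.1.+1) || (e == (1%N, n)).

Definition one_based d : nat * nat := ((d.1 : nat).+1, (d.2 : nat).+1).

Lemma one_based_inj : injective one_based.
Proof. by case=> [a b] [a' b'] [] /val_inj-> /val_inj->. Qed.

Lemma cross_sym e f : cross e f = cross f e.
Proof. by rewrite /cross orbC. Qed.

Lemma cross_one_based d d' : cross (one_based d) (one_based d') = crossing d d'.
Proof. by rewrite /cross /crossing /= !ltnS. Qed.

Lemma cross_side e f : edge n f -> side e -> ~~ cross e f.
Proof.
rewrite /edge /side /cross; case: e f => s t [s' t'] /= ef; rewrite xpair_eqE.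
by move=> /orP[/eqP->|/andP[/eqP-> /eqP->]]; lia.
Qed.

Lemma one_based_edge d : is_diag d -> edge n (one_based d).
Proof. by move=> /andP[lt _]; rewrite /edge /= !ltnS ltn_ord; lia. Qed.

Lemma one_based_side d : is_diag d -> ~~ side (one_based d).
Proof. by rewrite /is_diag /side /one_based xpair_eqE /=; lia. Qed.

Lemma side_or_diag e : edge n e -> side e \/ exists2 d, is_diag d & e = one_based d.
Proof.
case: e => s t ee; case: (boolP (side (s, t))) => [|ns]; [by left | right].
have [/= st tn] := andP ee.
have sn : (s.-1 < n)%N by lia.
have tn' : (t.-1 < n)%N by lia.
exists (Ordinal sn, Ordinal tn'); last by congr (_, _) => /=; lia.
by move: ns; rewrite /side /is_diag xpair_eqE /=; lia.
Qed.

Lemma side_tri_pairs sigma e : edge n e -> side e -> e \in tri_pairs sigma.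
Proof.
case: e => s t /andP[/= st tn]; rewrite /side !mem_cat inE => /orP[/= /eqP ts|->]; last by rewrite orbT.
by apply/orP; left; apply/mapP; exists s; rewrite ?mem_iota ?ts //; lia.
Qed.

Lemma diag_tri_pairs sigma d : d \in sigma -> one_based d \in tri_pairs sigma.
Proof.
by move=> ds; rewrite !mem_cat; apply/orP; right; apply/orP; right; apply/mapP; exists d; rewrite ?mem_enum.
Qed.

Lemma tri_pairsP sigma e : e \in tri_pairs sigma ->
  edge n e /\ side e \/ exists2 d, d \in sigma & e = one_based d.
Proof.
rewrite !mem_cat inE => /or3P[/mapP[s]|/eqP->|/mapP[d]].
- by rewrite mem_iota => h ->; left; rewrite /edge /side /= eqxx; split=> //; lia.
- by left; rewrite /edge /side /= eqxx orbT; split=> //; lia.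
- by rewrite mem_enum => ds ->; right; exists d.
Qed.

Lemma tri_pairs_uniq sigma : (forall d, d \in sigma -> is_diag d) -> uniq (tri_pairs sigma).
Proof.
move=> diag; rewrite !cat_uniq; apply/and3P; split.
- by rewrite map_inj_uniq ?iota_uniq // => a b [].
- apply/hasPn=> e; rewrite mem_cat inE => /orP[/eqP->|/mapP[d]].
    by apply/negP => /mapP[s _ []]; lia.
  rewrite mem_enum => /diag/one_based_side; rewrite /side negb_or => /andP[nd _] ->.
  by apply/negP => /mapP[s _ es]; move: nd; rewrite /one_based es /= eqxx.
- rewrite /= map_inj_uniq ?enum_uniq ?andbT; last exact: one_based_inj.
  apply/hasPn => _ /mapP[d + ->]; rewrite mem_enum => /diag/one_based_side.
  by rewrite /side negb_or inE => /andP[].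
Qed.

Section Maximal.
Variable sigma : {set 'I_n * 'I_n}.
Hypothesis tri : triangulation sigma.

Lemma tri_pairs_edge e : e \in tri_pairs sigma -> edge n e.
Proof. by have [diag _ _] := tri; case/tri_pairsP => [[]|[d /diag/one_based_edge + ->]]. Qed.

Lemma tri_pairs_noncrossing e f : e \in tri_pairs sigma -> f \in tri_pairs sigma -> ~~ cross e f.
Proof.
have [_ ncr _] := tri; move=> eT fT; have ee := tri_pairs_edge eT; have ef := tri_pairs_edge fT.
case/tri_pairsP: eT => [[_ se]|[d ds ed]]; first exact: cross_side.
case/tri_pairsP: fT => [[_ sf]|[d' ds' fd]]; first by rewrite cross_sym cross_side.
by rewrite ed fd cross_one_based ncr.
Qed.

Lemma tri_pairs_maximal e : edge n e -> (forall f, f \in tri_pairs sigma -> ~~ cross f e) ->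
  e \in tri_pairs sigma.
Proof.
have [_ _ mx] := tri; move=> ee ncr.
have [se|[d dd ed]] := side_or_diag ee; first exact: side_tri_pairs.
case: (boolP (d \in sigma)) => [/diag_tri_pairs|/(mx _ dd)[f fs cf]]; first by rewrite ed.
have := ncr _ (diag_tri_pairs fs); rewrite ed cross_sym cross_one_based; by rewrite cf.
Qed.

End Maximal.

(** Sides cross no edge, so maximality puts all of them into [s]; the remaining members of [s] are
    the diagonals of the triangulation. *)
Lemma maximal_noncrossing_triangulation (s : seq (nat * nat)) : uniq s -> all (edge n) s ->
  (forall e f, e \in s -> f \in s -> ~~ cross e f) ->
  (forall e, edge n e -> (forall f, f \in s -> ~~ cross f e) -> e \in s) ->
  exists sigma, triangulation sigma /\ perm_eq s (tri_pairs sigma).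
Proof.
move=> us es ncr mx.
pose sigma := [set d : 'I_n * 'I_n | is_diag d & one_based d \in s].
have sub d : d \in sigma -> is_diag d by rewrite inE => /andP[].
exists sigma; split; first split=> //.
- by move=> d d'; rewrite !inE => /andP[_ ds] /andP[_ ds']; rewrite -cross_one_based ncr.
- move=> d dd; rewrite inE dd /= => ds.
  have /hasP[f fs cf] : has (fun f => cross f (one_based d)) s.
    by apply: contraNT ds => /hasPn nc; apply: mx => //; apply: one_based_edge.
  have [sf|[d' dd' fd']] := side_or_diag (allP es _ fs).
    by have := cross_side (one_based_edge dd) sf; rewrite cf.
  exists d'; first by rewrite inE dd' -fd'.
  by rewrite -cross_one_based cross_sym -fd'.
apply: uniq_perm => // [|e]; first exact: tri_pairs_uniq.
apply/idP/idP => [ein|/tri_pairsP[[ee se]|[d + ->]]].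
- have [se|[d dd ed]] := side_or_diag (allP es _ ein).
    by apply: side_tri_pairs => //; apply: (allP es).
  by rewrite ed diag_tri_pairs // inE dd -ed.
- by apply: mx => // f fs; rewrite cross_sym cross_side // (allP es).
- by rewrite inE => /andP[].
Qed.

End Triangulations.

Section ClusterTilting.
Variables (K : fieldType) (n : nat).
Hypothesis n3 : (2 < n)%N.
Implicit Types (M N T X Z : lmod K n).

(** Modules have no decidable equality, so lists of them are indexed by ordinals before the lemmas
    on [dsum_list (map F s)] are applied. *)
Lemma seq_nth_enum (s : seq (lmod K n)) :
  s = [seq nth (zero_mod K n) s i | i : 'I_(size s) <- enum 'I_(size s)].
Proof.
by rewrite -[LHS](mkseq_nth (zero_mod K n)) /mkseq -val_enum_ord -map_comp.
Qed.

Lemma in_add_all_inner_r T M Z : all_inner M T -> in_add T Z -> all_inner M Z.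
Proof.
move=> inn [s [sT isoZ]]; apply: all_inner_summandr (iso_summand isoZ) _.
rewrite (seq_nth_enum s); apply: all_inner_listr => i _.
by apply: all_inner_summandr inn; apply: sT.
Qed.

Lemma in_add_all_inner_l T N Z : all_inner T N -> in_add T Z -> all_inner Z N.
Proof.
move=> inn [s [sT isoZ]]; apply: all_inner_summandl (iso_summand isoZ) _.
rewrite (seq_nth_enum s); apply: all_inner_listl => i _.
by apply: all_inner_summandl inn; apply: sT.
Qed.

(** If an Ext group with T vanishes, no piece (s,t) of Z crosses an edge of T, since Ext passes to
    summands; maximality of the triangulation then puts every piece into add T. Crossing is
    symmetric, so both sides are alike. *)
Lemma T_sigma_cluster_tilting (sigma : {set 'I_n * 'I_n}) : triangulation sigma ->
  cluster_tilting (T_sigma K sigma).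
Proof.
move=> tri; pose s := tri_pairs sigma; pose T := T_sigma K sigma.
have es : all (edge n) s by apply/allP => e; apply: tri_pairs_edge.
have eT : T = dsum_list (map (edge_mod K n) s) by [].
have cT : is_CM T.
  by rewrite eT; apply: dsum_list_CM => e /(allP es); apply: edge_mod_CM.
have innT : all_inner T T.
  rewrite eT; apply: all_inner_listl => e ei; apply: all_inner_listr => f fi.
  by apply: noncrossing_all_inner => //; rewrite ?(allP es) // (tri_pairs_noncrossing n3 tri).
have addZ Z es' : all (edge n) es' -> iso Z (dsum_list (map (edge_mod K n) es')) ->
    (forall e, e \in es' -> forall f, f \in s -> ~~ cross f e) -> in_add T Z.
  move=> ees' isoZ ncr; exists (map (edge_mod K n) es'); split=> // i; rewrite size_map => lti.
  rewrite (nth_map (0, 0)%N) // eT; apply: dsum_list_summand.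
  by apply: (tri_pairs_maximal n3 tri); [apply: (allP ees') | apply: ncr]; rewrite mem_nth.
split=> // Z cZ; have [es' ees' isoZ] := CM_classification n3 cZ.
have sumZ e : e \in es' -> summand (edge_mod K n e) Z.
  move=> ei; apply: summand_trans (iso_summand (iso_sym isoZ)); exact: dsum_list_summand.
split; split.
- by move=> aZ; apply: all_inner_ext1_zero => //; apply: in_add_all_inner_r aZ.
- move=> /(ext1_zero_all_inner cT cZ) inn; apply: (addZ _ es') => // e ei f fi.
  apply/negP => cr; apply: (crossing_not_all_inner n3 (allP es _ fi) (allP ees' _ ei) cr).
  apply: all_inner_summandr (sumZ _ ei) _; apply: all_inner_summandl inn.
  by rewrite eT; apply: dsum_list_summand.
- by move=> aZ; apply: all_inner_ext1_zero => //; apply: in_add_all_inner_l aZ.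
- move=> /(ext1_zero_all_inner cZ cT) inn; apply: (addZ _ es') => // e ei f fi.
  apply/negP; rewrite cross_sym => cr.
  apply: (crossing_not_all_inner n3 (allP ees' _ ei) (allP es _ fi) cr).
  apply: all_inner_summandl (sumZ _ ei) _; apply: all_inner_summandr inn.
  by rewrite eT; apply: dsum_list_summand.
Qed.

Lemma T_sigma_basic (sigma : {set 'I_n * 'I_n}) : triangulation sigma -> basic (T_sigma K sigma).
Proof.
move=> tri; pose s := tri_pairs sigma.
have us : uniq s by have [diag _ _] := tri; apply: tri_pairs_uniq.
have ee i : (i < size s)%N -> edge n (nth (0, 0)%N s i).
  by move=> lt; apply: (tri_pairs_edge n3 tri); apply: mem_nth.
exists (map (edge_mod K n) s); rewrite size_map; split=> [|i lti|i j lti ltj nij].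
- exact: iso_refl.
- by rewrite (nth_map (0, 0)%N) //; apply: edge_mod_indecomposable => //; apply: ee.
- rewrite !(nth_map (0, 0)%N) // => /(edge_mod_inj n3 (ee _ lti) (ee _ ltj))/eqP.
  by rewrite nth_uniq // => /eqP.
Qed.

Lemma T_sigma_iso_sub (sigma sigma' : {set 'I_n * 'I_n}) :
  triangulation sigma -> triangulation sigma' ->
  iso (T_sigma K sigma) (T_sigma K sigma') -> sigma \subset sigma'.
Proof.
move=> tri tri' isoT; apply/subsetP => d ds.
have [diag _ _] := tri.
have : one_based d \in tri_pairs sigma'.
  apply: (@edge_summand_mem K n n3).
  - exact: one_based_edge (diag _ ds).
  - by apply/allP => e; apply: tri_pairs_edge.
  apply: summand_trans (iso_summand isoT).
  by apply: (dsum_list_summand (edge_mod K n)); apply: diag_tri_pairs.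
case/tri_pairsP=> // [[_ sd]|[d' ds' /one_based_inj-> //]].
by have := one_based_side n3 (diag _ ds); rewrite sd.
Qed.

Lemma basic_cluster_tilting_T_sigma T : basic T -> cluster_tilting T ->
  exists sigma : {set 'I_n * 'I_n}, triangulation sigma /\ iso T (T_sigma K sigma).
Proof.
case=> s [isoT ind niso] [cT clus]; pose z := zero_mod K n.
have eqs := congr1 (@dsum_list K n) (seq_nth_enum s).
have sumT (i : 'I_(size s)) : summand (nth z s i) T.
  apply: summand_trans (iso_summand (iso_sym isoT)).
  rewrite eqs; apply: (dsum_list_summand (fun i : 'I_(size s) => nth z s i)).
  by rewrite mem_enum.
have /fin_all_exists [e he] : forall i : 'I_(size s),
    exists e, edge n e /\ iso (nth z s i) (edge_mod K n e).
  move=> i; have [|e ee ie] := indecomposable_CM n3 _ (ind i (ltn_ord i)).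
    exact: summand_CM cT (sumT i).
  by exists e.
pose es := [seq e i | i <- enum 'I_(size s)].
have ees : all (edge n) es by apply/allP => _ /mapP[i _ ->]; case: (he i).
have isoes : iso T (dsum_list (map (edge_mod K n) es)).
  apply: iso_trans isoT _; rewrite eqs /es -map_comp.
  elim: (enum 'I_(size s)) => [|i r IH] /=; first exact: iso_refl.
  by apply: dsum_iso IH; case: (he i).
have ues : uniq es.
  rewrite map_inj_in_uniq ?enum_uniq // => i j _ _ eij; apply/val_inj/eqP; apply: contraT => /eqP nij.
  case: (niso i j (ltn_ord i) (ltn_ord j) nij); have [_ ii] := he i; have [_ ij] := he j.
  by apply: iso_trans ii _; rewrite eij; apply: iso_sym.
have sume f : f \in es -> summand (edge_mod K n f) T.
  by move=> fi; apply: summand_trans (iso_summand (iso_sym isoes)); apply: dsum_list_summand.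
(* T lies in its own add, so it has no self-extensions and its edges do not cross. *)
have innT : all_inner T T.
  apply: ext1_zero_all_inner => //; apply/(clus T cT).1.
  exists [:: T]; split; last by apply: iso_sym; apply: dsum_rk0r.
  by case=> // _; apply: iso_summand; apply: iso_refl.
have [f g fi gi|f ef ncr|sigma [tri pe]] := maximal_noncrossing_triangulation n3 ues ees.
- apply/negP => cr; apply: (crossing_not_all_inner n3 (allP ees _ fi) (allP ees _ gi) cr).
  apply: all_inner_summandl (sume _ fi) _; exact: all_inner_summandr (sume _ gi) innT.
(* An edge crossing none of those of T is Ext-orthogonal to T, hence in add T; being indecomposable,
   it is a summand of T and occurs in the list. *)
- apply: (@edge_summand_mem K n n3) => //.
  apply: summand_trans (iso_summand isoes).
  apply: (indecomposable_in_add n3 (edge_mod_indecomposable K n3 ef)).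
  apply/(clus _ (edge_mod_CM K n3 ef)).1; apply: all_inner_ext1_zero => //.
  apply: all_inner_summandl (iso_summand isoes) _; apply: all_inner_listl => g gi.
  by apply: noncrossing_all_inner => //; [apply: (allP ees) | apply: ncr].
exists sigma; split=> //; apply: iso_trans isoes _.
exact: dsum_list_perm pe.
Qed.

End ClusterTilting.

Theorem theorem3p13 (K : fieldType) (n : nat) (hn : (3 <= n)%N) :
  (forall sigma : {set 'I_n * 'I_n}, triangulation sigma ->
      basic (T_sigma K sigma) /\ cluster_tilting (T_sigma K sigma)) /\
  (forall sigma sigma' : {set 'I_n * 'I_n}, triangulation sigma -> triangulation sigma' ->
      iso (T_sigma K sigma) (T_sigma K sigma') -> sigma = sigma') /\
  (forall T : lmod K n, basic T -> cluster_tilting T ->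
      exists sigma : {set 'I_n * 'I_n}, triangulation sigma /\ iso T (T_sigma K sigma)).
Proof.
split=> [sigma tri|]; first by split; [apply: T_sigma_basic | apply: T_sigma_cluster_tilting].
split=> [sigma sigma' tri tri' isoT|T]; last exact: basic_cluster_tilting_T_sigma.
apply/eqP; rewrite eqEsubset (T_sigma_iso_sub hn tri tri' isoT).
exact: (T_sigma_iso_sub hn tri' tri (iso_sym isoT)).
Qed.
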